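(* Let $\alpha\ge0$ and $f\in L^2(\Omega)$. If $u\in W_\alpha(\Omega)$ satisfies $$\int_\Omega \nabla u\cdot\nabla\overline{v}+u\overline{v}\,dxdy-\int_{\Gamma_-}|x|^\alpha\,\partial_xu\,\partial_x\overline{v}\,dx+\int_{\Gamma_+}x^\alpha\,\partial_xu\,\partial_x\overline{v}\,dx=\int_\Omega f\overline{v}\,dxdy\qquad\text{for all }v\in W_\alpha(\Omega),$$ then $u$ solves $$-\Delta u+u=f\ \text{ in }\Omega,\qquad\partial_\nu u=0\ \text{ on }\Gamma_0,\qquad\partial_\nu u=-\partial_x(|x|^\alpha\,\partial_xu)\ \text{ on }\Gamma_-,\qquad\partial_\nu u=\partial_x(x^\alpha\,\partial_xu)\ \text{ on }\Gamma_+,$$ where the conditions on $\Gamma_-$ and $\Gamma_+$ hold in $\mathcal{D}'(\Gamma_-)$ and $\mathcal{D}'(\Gamma_+)$ respectively (distributional sense).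
   Context: $\Omega\subset\mathbb{R}^2$ is an open, connected, bounded set with Lipschitz continuous boundary $\partial\Omega$ such that $\Gamma:=(-1,1)\times\{0\}\subset\partial\Omega$. Set $\Gamma_0:=\partial\Omega\setminus\overline{\Gamma}$, $\Gamma_-:=(-1,0)\times\{0\}$, $\Gamma_+:=(0,1)\times\{0\}$ (the last two identified with $(-1,0)$ and $(0,1)$), and let $\nu$ be the outward unit normal vector to $\partial\Omega$. Functions are complex-valued. For $v\in H^1(\Omega)$, $\partial_xv$ on $\Gamma_\pm$ is the distributional derivative along $\Gamma_\pm$ of the trace $v|_{\Gamma_\pm}$. Define $$W_\alpha(\Omega):=\{v\in H^1(\Omega)\,|\,|x|^{\alpha/2}\partial_xv\in L^2(\Gamma_-),\ x^{\alpha/2}\partial_xv\in L^2(\Gamma_+)\}.$$ The equation in $\Omega$ is understood in $\mathcal{D}'(\Omega)$. For $u\in H^1(\Omega)$ with $\Delta u\in L^2(\Omega)$, $\partial_\nu u\in H^{-1/2}(\partial\Omega)$ is defined by the Green formula $\langle\partial_\nu u,\overline{v}\rangle=\int_\Omega\nabla u\cdot\nabla\overline{v}+\Delta u\,\overline{v}\,dxdy$ for all $v\in H^1(\Omega)$. The condition $\partial_\nu u=0$ on $\Gamma_0$ means $\langle\partial_\nu u,\overline{\phi}\rangle=0$ for all $\phi\in H^{1/2}(\partial\Omega)$ that vanish on $\Gamma$. *)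

(* Defs.v *)
From HB Require Import structures.
From mathcomp Require Export all_boot all_order all_algebra.
From mathcomp Require Export all_classical all_reals all_analysis.
From mathcomp.real_closed Require Export complex.
Export Order.TTheory GRing.Theory Num.Theory numFieldNormedType.Exports.

Set Implicit Arguments.
Unset Strict Implicit.
Unset Printing Implicit Defensive.

Local Open Scope classical_set_scope.
Local Open Scope ring_scope.
Local Open Scope complex_scope.

Notation leb1 R := (@lebesgue_measure R).
Notation leb2 R := (@lebesgue_measure R \x @lebesgue_measure R)%E.

Section ComplexFunctions.
Context {R : realType}.
Local Notation C := (R[i]).

Definition ReF {T : Type} (f : T -> C) : T -> R := fun x => complex.Re (f x).
Definition ImF {T : Type} (f : T -> C) : T -> R := fun x => complex.Im (f x).
Definition conjF {T : Type} (f : T -> C) : T -> C := fun x => conjc (f x).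

(* the squared modulus, as a real number *)
Definition sqmod (z : C) : R := complex.Re z ^+ 2 + complex.Im z ^+ 2.

Definition cint {d} {T : measurableType d} (mu : {measure set T -> \bar R})
    (D : set T) (f : T -> C) : C :=
  (Rintegral mu D (ReF f)) +i* (Rintegral mu D (ImF f)).

Definition cmeasurable {d} {T : measurableType d} (D : set T) (f : T -> C) : Prop :=
  measurable_fun D (ReF f) /\ measurable_fun D (ImF f).

(* the squared L2 distance, as an extended real *)
Definition dist2 {d} {T : measurableType d} (mu : {measure set T -> \bar R})
    (D : set T) (f g : T -> C) : \bar R :=
  (\int[mu]_(x in D) (sqmod (f x - g x))%:E)%E.

Definition L2 {d} {T : measurableType d} (mu : {measure set T -> \bar R})
    (D : set T) (f : T -> C) : Prop :=
  cmeasurable D f /\ (\int[mu]_(x in D) (sqmod (f x))%:E < +oo)%E.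

End ComplexFunctions.

Section TestFunctions.
Context {R : realType} {V : normedModType R}.
Local Notation C := (R[i]).

Definition iter_derive (vs : seq V) (f : V -> R) : V -> R :=
  foldr (fun v g => 'D_v g) f vs.

Definition smooth (f : V -> R) : Prop :=
  forall vs : seq V,
    continuous (iter_derive vs f) /\
    (forall x v : V, derivable (iter_derive vs f) x v).

Definition cderive (v : V) (f : V -> C) : V -> C :=
  fun x => ('D_v (ReF f) x) +i* ('D_v (ImF f) x).

(* phi \in D(O), the smooth functions with compact support in O *)
Definition test_function (O : set V) (phi : V -> C) : Prop :=
  [/\ smooth (ReF phi), smooth (ImF phi) &
      exists K : set V, [/\ compact K, K `<=` O &
                            forall x, ~ K x -> phi x = 0]].

End TestFunctions.

Section LipschitzBoundary.
Context {R : realType}.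

Definition bdry (O : set (R * R)) : set (R * R) := closure O `\` interior O.

(* A local chart: an origin, a frame (a, b), (-b, a), a window of half-sizes r
   and d in that frame, and a function h whose graph describes the boundary. *)
Record chart := Chart {
  ch_p : R * R;
  ch_a : R;
  ch_b : R;
  ch_r : R;
  ch_d : R;
  ch_h : R -> R }.

Definition chart_pt (c : chart) (s t : R) : R * R :=
  ((ch_p c).1 + s * ch_a c - t * ch_b c, (ch_p c).2 + s * ch_b c + t * ch_a c).

Definition chart_dom (c : chart) : set R := [set` `]- ch_r c, ch_r c[].

Definition lip_chart (O : set (R * R)) (c : chart) : Prop :=
  [/\ ch_a c ^+ 2 + ch_b c ^+ 2 = 1,
      0 < ch_r c /\ 0 < ch_d c,
      [lipschitz ch_h c x | x in chart_dom c],
      forall s, chart_dom c s -> `|ch_h c s| < ch_d c &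
      forall s t, chart_dom c s -> `|t| < ch_d c ->
        (O (chart_pt c s t) <-> ch_h c s < t) /\
        (bdry O (chart_pt c s t) <-> t = ch_h c s)].

Definition lipschitz_boundary (O : set (R * R)) : Prop :=
  forall p, bdry O p -> exists c, ch_p c = p /\ lip_chart O c.

(* Convergence in L2 of the boundary, read in the charts: the surface element
   sqrt (1 + h'^2) lies between two positive constants, and finitely many
   charts cover a compact Lipschitz boundary. *)
Definition bdry_L2_cvg (O : set (R * R)) (v : nat -> R * R -> R[i])
    (g : R * R -> R[i]) : Prop :=
  forall c, lip_chart O c ->
    dist2 (leb1 R) (chart_dom c)
      (fun s => v n (chart_pt c s (ch_h c s)))
      (fun s => g (chart_pt c s (ch_h c s))) @[n --> \oo] --> 0%E.

End LipschitzBoundary.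

Section Sobolev.
Context {R : realType}.
Local Notation C := (R[i]).

Definition dir_x : R * R := (1, 0).
Definition dir_y : R * R := (0, 1).

Definition weak_deriv (O : set (R * R)) (e : R * R) (u g : R * R -> C) : Prop :=
  forall phi, test_function O phi ->
    cint (leb2 R) O (fun p => u p * cderive e phi p) =
    - cint (leb2 R) O (fun p => g p * phi p).

(* An element of H^1(O), bundled with its weak gradient (which is unique up to
   null sets). *)
Record H1 (O : set (R * R)) := MkH1 {
  h1_val :> R * R -> C;
  h1_dx : R * R -> C;
  h1_dy : R * R -> C;
  h1_L2 : L2 (leb2 R) O h1_val;
  h1_dx_L2 : L2 (leb2 R) O h1_dx;
  h1_dy_L2 : L2 (leb2 R) O h1_dy;
  h1_dxP : weak_deriv O dir_x h1_val h1_dx;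
  h1_dyP : weak_deriv O dir_y h1_val h1_dy }.

Definition H1_dist2 (O : set (R * R)) (u v : H1 O) : \bar R :=
  (dist2 (leb2 R) O u v + dist2 (leb2 R) O (h1_dx u) (h1_dx v)
   + dist2 (leb2 R) O (h1_dy u) (h1_dy v))%E.

(* g is (a Borel representative of) the trace of v: the trace operator is the
   continuous extension H^1(O) -> L^2(bdry O) of the restriction to the boundary,
   defined on the dense subspace of elements of H^1(O) continuous on closure O. *)
Definition is_trace (O : set (R * R)) (v : H1 O) (g : R * R -> C) : Prop :=
  cmeasurable (bdry O) g /\
  exists w : nat -> H1 O,
    [/\ forall n, {within closure O, continuous (ReF (w n))} /\
                  {within closure O, continuous (ImF (w n))},
        H1_dist2 (w n) v @[n --> \oo] --> 0%E &
        bdry_L2_cvg O (fun n => h1_val (w n)) g].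

(* H^{1/2}(bdry O), as the range of the trace operator on H^1(O) *)
Definition Hhalf (O : set (R * R)) (g : R * R -> C) : Prop :=
  exists v : H1 O, is_trace v g.

Definition Gamma : set R := [set` `](-1), 1[].
Definition Gamma_m : set R := [set` `](-1), 0[].
Definition Gamma_p : set R := [set` `]0, 1[].

(* <d_x q, psi> for q locally integrable on the open interval I *)
Definition distr_dx (I : set R) (q : R -> C) (psi : R -> C) : C :=
  - cint (leb1 R) I (fun x => q x * cderive (1 : R) psi x).

(* p = d_x q in D'(I) *)
Definition is_distr_dx (I : set R) (q p : R -> C) : Prop :=
  forall psi, test_function I psi ->
    cint (leb1 R) I (fun x => p x * psi x) = distr_dx I q psi.

(* An element of W_alpha(O), bundled with its trace and the derivatives of the
   trace along Gamma_- and Gamma_+ (all unique up to null sets). *)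
Record Walpha (O : set (R * R)) (alpha : R) := MkWalpha {
  w_H1 :> H1 O;
  w_trace : R * R -> C;
  w_dm : R -> C;
  w_dp : R -> C;
  w_traceP : is_trace w_H1 w_trace;
  w_dmP : is_distr_dx Gamma_m (fun x => w_trace (x, 0)) w_dm;
  w_dpP : is_distr_dx Gamma_p (fun x => w_trace (x, 0)) w_dp;
  w_dm_L2 : L2 (leb1 R) Gamma_m (fun x => (`|x| `^ (alpha / 2))%:C * w_dm x);
  w_dp_L2 : L2 (leb1 R) Gamma_p (fun x => (x `^ (alpha / 2))%:C * w_dp x) }.

Definition grad_prod (O : set (R * R)) (u v : H1 O) (p : R * R) : C :=
  h1_dx u p * conjc (h1_dx v p) + h1_dy u p * conjc (h1_dy v p).

Definition form (O : set (R * R)) (alpha : R) (u v : Walpha O alpha) : C :=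
  cint (leb2 R) O (fun p => grad_prod u v p + u p * conjc (v p))
  - cint (leb1 R) Gamma_m
      (fun x => (`|x| `^ alpha)%:C * w_dm u x * conjc (w_dm v x))
  + cint (leb1 R) Gamma_p
      (fun x => (x `^ alpha)%:C * w_dp u x * conjc (w_dp v x)).

Definition laplacian (phi : R * R -> C) : R * R -> C :=
  fun p => cderive dir_x (cderive dir_x phi) p + cderive dir_y (cderive dir_y phi) p.

(* <Delta u, phi> *)
Definition distr_laplacian (O : set (R * R)) (u phi : R * R -> C) : C :=
  cint (leb2 R) O (fun p => u p * laplacian phi p).

(* - Delta u + u = f in D'(O) *)
Definition solves_pde (O : set (R * R)) (u f : R * R -> C) : Prop :=
  forall phi, test_function O phi ->
    - distr_laplacian O u phi + cint (leb2 R) O (fun p => u p * phi p) =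
    cint (leb2 R) O (fun p => f p * phi p).

(* Delta u \in L^2(O) and l is the linear functional <d_nu u, .> on H^{1/2}(bdry O),
   given by Green's formula; l is only constrained on H^{1/2}(bdry O). *)
Definition is_normal_derivative (O : set (R * R)) (u : H1 O)
    (l : (R * R -> C) -> C) : Prop :=
  exists w : R * R -> C,
    [/\ L2 (leb2 R) O w,
        forall phi, test_function O phi ->
          cint (leb2 R) O (fun p => w p * phi p) = distr_laplacian O u phi &
        forall (v : H1 O) (g : R * R -> C), is_trace v g ->
          l (conjF g) =
          cint (leb2 R) O (fun p => grad_prod u v p + w p * conjc (v p))].

Definition zero_on_Gamma0 (O : set (R * R)) (l : (R * R -> C) -> C) : Prop :=
  forall phi, Hhalf O phi ->
    {ae @lebesgue_measure R, forall x, Gamma x -> phi (x, 0) = 0} ->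
    l (conjF phi) = 0.

(* the extension by zero to the boundary of psi, supported in Gamma *)
Definition zero_ext (psi : R -> C) : R * R -> C :=
  fun p => if p.2 == 0 then psi p.1 else 0.

(* l = T in D'(I), for I one of Gamma_-, Gamma_+; test functions extended by zero
   must belong to H^{1/2}(bdry O), where l is defined. *)
Definition eq_distr_on (O : set (R * R)) (l : (R * R -> C) -> C) (I : set R)
    (T : (R -> C) -> C) : Prop :=
  forall psi, test_function I psi ->
    Hhalf O (zero_ext psi) /\ l (zero_ext psi) = T psi.

End Sobolev.

(* Main.v *)
Require Import Defs.
From mathcomp Require Import measurable_realfun ring lra.

(** Write [w := u - f] and let [green v] be the integral over the domain of
  [grad u . grad (conj v) + w * conj v]. Subtracting the right-hand side from
  the weak formulation says that, for every admissible [v], [green v] is the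
  integral over [Gamma_m] minus the integral over [Gamma_p] of the weighted
  products of the derivatives of [u] and [conj v] along the boundary
  ([green_Walpha]). The theorem follows by choosing [v].

  If the trace of [v] vanishes almost everywhere on [Gamma], then [v] is
  admissible with zero derivatives along [Gamma], hence [green v = 0]
  ([green_null_trace]). Applied to the difference of two functions with the same
  trace, this shows that [green v] depends only on the trace of [v]
  ([green_trace]): the weak formulation itself makes the normal derivative a well
  defined functional of the trace. Applied to the conjugate of a test function of
  the domain, it gives [Delta u = u - f] ([green_test_function]). Applied to traces
  supported in the rest of the boundary, it gives the Neumann condition there.

  For the conditions on [Gamma_m] and [Gamma_p] one needs, for a test function
  [psi] of [Gamma], an element of H^1 whose trace is [psi] extended by zero. The
  product of [psi x] with a cutoff in [y] works as soon as the cutoff lives on a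
  strip around the support of [psi] in which the boundary contains nothing but
  [Gamma]. Such a strip exists because a Lipschitz graph containing a segment
  coincides with it near each of its interior points ([bdry_flat_near]), and by
  compactness of the support ([bdry_flat_compact]).

  The analytic input is integration by parts against compactly supported
  functions that are C^1 along one axis ([integral_partial_eq0]): Fubini's
  theorem and the fundamental theorem of calculus on lines. *)

Set Implicit Arguments.
Unset Strict Implicit.
Unset Printing Implicit Defensive.

Local Open Scope classical_set_scope.
Local Open Scope ring_scope.
Local Open Scope complex_scope.

(** * Measurability in the plane *)

Section PlaneMeasurability.
Context {R : realType}.

(** The product sigma-algebra is generated by rectangles, so openness is converted
  into a countable union of products of rational intervals. *)
Lemma open_measurable_plane (O : set (R * R)) : open O -> measurable O.
Proof.
move=> oO.
pose B (q : rat * rat * rat * rat) : set (R * R) :=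
  ball (ratr q.1.1.1 : R) (ratr q.1.1.2 : R) `*` ball (ratr q.1.2 : R) (ratr q.2 : R).
have -> : O = \bigcup_q (if `[< B q `<=` O >] then B q else set0).
  rewrite -bigcup_mkcond.
  apply/seteqP; split => [[x y] Oxy|p [q /= + qp]]; last first.
    exact.
  have [[U V]/= [Ux Vy] UVO] := open_nbhs_nbhs (conj oO Oxy).
  have [c1 [r1 [/set_mem x1 s1]]] :=
    open_subball_rat (open_interior U) (mem_set (nbhs_singleton (nbhs_interior Ux))).
  have [c2 [r2 [/set_mem y2 s2]]] :=
    open_subball_rat (open_interior V) (mem_set (nbhs_singleton (nbhs_interior Vy))).
  exists (c1, r1, c2, r2) => //= -[a b] [/= Ba Bb].
  by apply: UVO; split; apply: interior_subset; [exact: s1|exact: s2].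
apply: countable_bigcupT_measurable => [|q]; first exact: countableP.
case: asboolP => _; last exact: measurable0.
apply: measurableX; apply: open_measurable; exact: ball_open.
Qed.

Lemma within_continuous_measurable_plane (D : set (R * R)) (f : R * R -> R) :
  measurable D -> {within D, continuous f} -> measurable_fun D f.
Proof.
move=> mD /continuousP cf.
apply: (measurability _ (RGenOpens.measurableE R)).
move=> _ [_ [a [b ->] <-]].
have /open_subspaceP [V oV VD] := cf _ (@interval_open R (BRight a) (BLeft b) isT isT).
by rewrite setIC -VD; apply: measurableI => //; exact: open_measurable_plane.
Qed.

Lemma continuous_measurable_plane (D : set (R * R)) (f : R * R -> R) :
  continuous f -> measurable_fun D f.
Proof.
move=> cf; apply: (@measurable_funS _ _ _ _ setT) => //.
apply: within_continuous_measurable_plane => //.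
exact: continuous_subspaceT.
Qed.

End PlaneMeasurability.

(** * Square-integrable complex functions *)

Section ComplexParts.
Context {R : realType} {T : Type}.
Implicit Types f g : T -> R[i].

Lemma ReF_mul f g :
  ReF (fun x => f x * g x) = (fun x => ReF f x * ReF g x - ImF f x * ImF g x).
Proof. by apply/funext => x; rewrite /ReF /ImF; case: (f x) (g x) => [? ?] []. Qed.

Lemma ImF_mul f g :
  ImF (fun x => f x * g x) = (fun x => ReF f x * ImF g x + ImF f x * ReF g x).
Proof. by apply/funext => x; rewrite /ReF /ImF; case: (f x) (g x) => [? ?] []. Qed.

Lemma ReF_add f g : ReF (fun x => f x + g x) = (fun x => ReF f x + ReF g x).
Proof. by apply/funext => x; rewrite /ReF; case: (f x) (g x) => [? ?] []. Qed.

Lemma ImF_add f g : ImF (fun x => f x + g x) = (fun x => ImF f x + ImF g x).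
Proof. by apply/funext => x; rewrite /ImF; case: (f x) (g x) => [? ?] []. Qed.

Lemma ReF_sub f g : ReF (fun x => f x - g x) = (fun x => ReF f x - ReF g x).
Proof. by apply/funext => x; rewrite /ReF; case: (f x) (g x) => [? ?] []. Qed.

Lemma ImF_sub f g : ImF (fun x => f x - g x) = (fun x => ImF f x - ImF g x).
Proof. by apply/funext => x; rewrite /ImF; case: (f x) (g x) => [? ?] []. Qed.

Lemma ReF_conj f : ReF (conjF f) = ReF f.
Proof. by apply/funext => x; rewrite /ReF /conjF; case: (f x). Qed.

Lemma ImF_conj f : ImF (conjF f) = (fun x => - ImF f x).
Proof. by apply/funext => x; rewrite /ImF /conjF; case: (f x). Qed.

Lemma conjF_involutive f : conjF (conjF f) = f.
Proof. by apply/funext => x; rewrite /conjF; case: (f x) => a b /=; rewrite opprK. Qed.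

End ComplexParts.

Section ComplexIntegral.
Context {R : realType} {d} {T : measurableType d}.
Variables (mu : {measure set T -> \bar R}) (D : set T).
Hypothesis mD : measurable D.
Implicit Types f g : T -> R[i].

Definition cintegrable f :=
  mu.-integrable D (EFin \o ReF f) /\ mu.-integrable D (EFin \o ImF f).

Lemma cintD f g : cintegrable f -> cintegrable g ->
  cint mu D (fun x => f x + g x) = cint mu D f + cint mu D g.
Proof.
move=> [rf jf] [rg jg].
by rewrite /cint ReF_add ImF_add !RintegralD.
Qed.

Lemma cintB f g : cintegrable f -> cintegrable g ->
  cint mu D (fun x => f x - g x) = cint mu D f - cint mu D g.
Proof.
move=> [rf jf] [rg jg].
by rewrite /cint ReF_sub ImF_sub !RintegralB.
Qed.

Lemma cintegrableD f g : cintegrable f -> cintegrable g ->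
  cintegrable (fun x => f x + g x).
Proof.
move=> [rf jf] [rg jg]; rewrite /cintegrable ReF_add ImF_add.
by split; [have := integrableD mD rf rg | have := integrableD mD jf jg].
Qed.

Lemma eq_cint f g : (forall x, D x -> f x = g x) -> cint mu D f = cint mu D g.
Proof.
by move=> fg; rewrite /cint /ReF /ImF; congr (_ +i* _); apply: eq_Rintegral => x
  /set_mem Dx; rewrite /= fg.
Qed.

Lemma cint_eq0 f : (forall x, D x -> f x = 0) -> cint mu D f = 0.
Proof.
move=> f0; rewrite (@eq_cint _ (fun=> 0))// /cint /ReF /ImF/=.
by rewrite /Rintegral integral0.
Qed.

Lemma cmeasurable_mul f g : cmeasurable D f -> cmeasurable D g ->
  cmeasurable D (fun x => f x * g x).
Proof.
move=> [? ?] [? ?]; rewrite /cmeasurable ReF_mul ImF_mul; split.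
  by apply: measurable_funB; exact: measurable_funM.
by apply: measurable_funD; exact: measurable_funM.
Qed.

Lemma cmeasurable_sub f g : cmeasurable D f -> cmeasurable D g ->
  cmeasurable D (fun x => f x - g x).
Proof.
by move=> [? ?] [? ?]; rewrite /cmeasurable ReF_sub ImF_sub; split; exact: measurable_funB.
Qed.

Lemma sqmod_ge0 (z : R[i]) : 0 <= sqmod z.
Proof. by rewrite /sqmod addr_ge0// sqr_ge0. Qed.

Lemma sqmod_le (z : R[i]) (A B : R) :
  `|complex.Re z| <= A -> `|complex.Im z| <= B -> sqmod z <= A ^+ 2 + B ^+ 2.
Proof.
move=> zA zB; rewrite /sqmod lerD// -real_normK ?num_real// lerXn2r ?nnegrE//.
  exact: le_trans zA.
exact: le_trans zB.
Qed.

Lemma measurable_sqmod f : cmeasurable D f -> measurable_fun D (fun x => sqmod (f x)).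
Proof.
move=> [rf jf].
by apply: measurable_funD; apply: measurable_funX.
Qed.

Lemma L2_integrable_sqmod f : L2 mu D f -> mu.-integrable D (EFin \o (fun x => sqmod (f x))).
Proof.
move=> [mf foo]; apply/integrableP; split.
  by apply/measurable_EFinP; exact: measurable_sqmod.
by under eq_integral do rewrite gee0_abs ?lee_fin ?sqmod_ge0//.
Qed.

Lemma L2_dominated f (h : T -> R) : cmeasurable D f -> mu.-integrable D (EFin \o h) ->
  (forall x, D x -> sqmod (f x) <= h x) -> L2 mu D f.
Proof.
move=> mf ih fh; split => //.
have : mu.-integrable D (EFin \o (fun x => sqmod (f x))).
  apply: le_integrable ih => //.
    by apply/measurable_EFinP; exact: measurable_sqmod.
  move=> x Dx; rewrite /= lee_fin ger0_norm ?sqmod_ge0//.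
  by rewrite (le_trans (fh _ Dx))// ler_norm.
move/integrableP => [_]; apply: le_lt_trans.
apply: ge0_le_integral => //.
- by move=> x _; rewrite lee_fin sqmod_ge0.
- by apply/measurable_EFinP; exact: measurable_sqmod.
- by do 2 apply: measurableT_comp => //; exact: measurable_sqmod.
- by move=> x _ /=; rewrite lee_fin ler_norm.
Qed.

Lemma L2_conj f : L2 mu D f -> L2 mu D (conjF f).
Proof.
move=> [[rf jf] foo]; split.
  rewrite /cmeasurable ReF_conj ImF_conj; split => //.
  exact: measurableT_comp.
rewrite (_ : (fun x => _) = (fun x => (sqmod (f x))%:E))//; apply/funext => x.
by rewrite /conjF /sqmod; case: (f x) => a b /=; rewrite sqrrN.
Qed.

Lemma sqmod_sub_le (z w : R[i]) : sqmod (z - w) <= 2 * (sqmod z + sqmod w).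
Proof.
rewrite /sqmod; case: z w => [a b] [c e] /=.
rewrite -subr_ge0.
rewrite (_ : _ - _ = (a + c) ^+ 2 + (b + e) ^+ 2); last by ring.
by rewrite addr_ge0// sqr_ge0.
Qed.

Lemma L2_sub f g : L2 mu D f -> L2 mu D g -> L2 mu D (fun x => f x - g x).
Proof.
move=> Lf Lg; apply: (@L2_dominated _ (fun x => 2 * (sqmod (f x) + sqmod (g x)))).
- by apply: cmeasurable_sub; [case: Lf|case: Lg].
- have := integrableZl mD 2 (integrableD mD (L2_integrable_sqmod Lf) (L2_integrable_sqmod Lg)).
  by apply: eq_integrable.
- by move=> x _; exact: sqmod_sub_le.
Qed.

(** The real and imaginary parts of [z * w] are bounded by [|z|^2 + |w|^2]. *)
Lemma L2_mul_integrable f g : L2 mu D f -> L2 mu D g -> cintegrable (fun x => f x * g x).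
Proof.
move=> Lf Lg.
have := integrableD mD (L2_integrable_sqmod Lf) (L2_integrable_sqmod Lg) => iS.
have [mf mg] : cmeasurable D f /\ cmeasurable D g by case: Lf; case: Lg.
have [rfg jfg] := cmeasurable_mul mf mg.
split; (apply: le_integrable iS; [exact: mD|exact/measurable_EFinP|]) => x Dx;
  (rewrite /= lee_fin [leRHS]ger0_norm; last by rewrite addr_ge0 ?sqmod_ge0);
  rewrite /ReF /ImF /sqmod; case: (f x) (g x) => [a b] [c e] /=;
  rewrite ler_norml.
  have := sqr_ge0 (a + c); have := sqr_ge0 (a - c).
  have := sqr_ge0 (b + e); have := sqr_ge0 (b - e).
  by move=> *; apply/andP; split; lra.
have := sqr_ge0 (a + e); have := sqr_ge0 (a - e).
have := sqr_ge0 (b + c); have := sqr_ge0 (b - c).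
by move=> *; apply/andP; split; lra.
Qed.

Lemma L2_bounded f (M : R) : (mu D < +oo)%E -> cmeasurable D f ->
  (forall x, D x -> sqmod (f x) <= M) -> L2 mu D f.
Proof.
move=> Doo mf fM; apply: (@L2_dominated _ (fun=> M)) => //.
apply/integrableP; split; first exact: measurable_cst.
by rewrite integral_cst// lte_mul_pinfty// lee_fin.
Qed.

(** The quadratic triangle inequality. Measurability is what makes the integral of
  nonnegative functions additive. *)
Lemma dist2_sub_le f1 f2 g1 g2 :
  cmeasurable D f1 -> cmeasurable D f2 -> cmeasurable D g1 -> cmeasurable D g2 ->
  (dist2 mu D (fun x => f1 x - f2 x)%R (fun x => g1 x - g2 x)%R <=
   2%:E * (dist2 mu D f1 g1 + dist2 mu D f2 g2))%E.
Proof.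
move=> mf1 mf2 mg1 mg2; rewrite /dist2.
have m1 : measurable_fun D (fun x => sqmod (f1 x - g1 x)).
  by apply: measurable_sqmod; exact: cmeasurable_sub.
have m2 : measurable_fun D (fun x => sqmod (f2 x - g2 x)).
  by apply: measurable_sqmod; exact: cmeasurable_sub.
rewrite -ge0_integralD//; first last.
- exact/measurable_EFinP.
- by move=> x _; rewrite lee_fin sqmod_ge0.
- exact/measurable_EFinP.
- by move=> x _; rewrite lee_fin sqmod_ge0.
rewrite -ge0_integralZl//; first last.
- by move=> x _; rewrite -EFinD lee_fin addr_ge0// sqmod_ge0.
- by apply/measurable_EFinP; exact: measurable_funD.
apply: ge0_le_integral => //.
- by move=> x _; rewrite lee_fin sqmod_ge0.
- apply/measurable_EFinP; apply: measurable_sqmod.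
  by apply: cmeasurable_sub; exact: cmeasurable_sub.
- apply/measurable_EFinP; apply: measurable_funM => //; exact: measurable_funD.
- move=> x _; rewrite -EFinD -EFinM lee_fin.
  rewrite (_ : f1 x - f2 x - (g1 x - g2 x) = (f1 x - g1 x) - (f2 x - g2 x)); last by ring.
  exact: sqmod_sub_le.
Qed.

End ComplexIntegral.

(** * Derivatives with compact support integrate to zero on the line *)

Section DirectionalC1.
Context {R : realType} {V : normedModType R}.
Implicit Types (F G : V -> R) (e : V).

(** Integrating by parts along lines parallel to [e] uses regularity in the
  direction [e] only, together with joint continuity for integrability. *)
Definition C1_along e F :=
  [/\ continuous F, forall x, derivable F x e & continuous ('D_e F)].

Lemma C1_alongM e F G : C1_along e F -> C1_along e G -> C1_along e (F * G).
Proof.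
move=> [cF dF cdF] [cG dG cdG]; split.
- by move=> x; apply: cvgM; [exact: cF|exact: cG].
- by move=> x; exact: derivableM.
- have -> : 'D_e (F * G) = (F * 'D_e G) + (G * 'D_e F).
    by apply/funext => x; rewrite deriveM.
  by move=> x; apply: cvgD; apply: cvgM; [exact: cF|exact: cdG|exact: cG|exact: cdF].
Qed.

Lemma derive_eq0_open (U : set V) e F : open U -> (forall x, U x -> F x = 0) ->
  forall x, U x -> 'D_e F x = 0.
Proof.
move=> oU F0 x Ux.
rewrite (@near_eq_derive _ _ _ _ (cst 0))//; first by rewrite derive_cst.
by apply: filterS (open_nbhs_nbhs (conj oU Ux)) => y /F0 ->.
Qed.

End DirectionalC1.

Section VanishingIntegrals.
Context {R : realType}.

Lemma bounded_support (V : normedModType R) (K : set V) : compact K ->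
  exists2 M : R, 0 < M & forall x, K x -> `|x| <= M.
Proof.
move=> /compact_bounded[M0 [_ HM]].
exists (Num.max 1 (M0 + 1)); first by rewrite lt_max ltr01.
move=> x Kx; apply: (HM _ _ x Kx).
by rewrite lt_max ltrDl ltr01 orbT.
Qed.

(** The fundamental theorem of calculus on an interval with endpoints outside the
  support. *)
Lemma integral_derive1_eq0 (F : R -> R) (M : R) : 0 < M ->
  C1_along (1 : R) F -> (forall x, M < `|x| -> F x = 0) ->
  (\int[leb1 R]_x ('D_1 F x)%:E = 0)%E.
Proof.
move=> M0 [cF dF cdF] F0.
have D0 x : M < `|x| -> 'D_1 F x = 0.
  move=> Mx; apply: (@derive_eq0_open R R [set x | M < `|x|] 1 F) => //.
  apply: (@open_comp _ _ (fun x : R => `|x|) [set x | M < x]); last exact: open_gt.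
  by move=> y _; exact: norm_continuous.
(* Enlarging the support bound by 1 makes [F] vanish at both endpoints. *)
pose I : set R := [set` `[- (M + 1), M + 1]].
transitivity (\int[leb1 R]_(x in I) ('D_1 F x)%:E)%E.
  rewrite [in RHS]integral_mkcond; apply: eq_integral => x _.
  rewrite patchE; case: ifPn => // /negP nI; rewrite D0//.
  rewrite ltNge; apply/negP => xM; apply: nI; apply/mem_set.
  rewrite /I/= in_itv/=; rewrite ler_norml in xM.
  by move/andP: xM => [? ?]; apply/andP; split; lra.
rewrite (@continuous_FTC2 R ('D_1 F) F); first by rewrite !F0 ?subee// ?normrN ger0_norm; lra.
- by lra.
- exact: continuous_subspaceT.
- split; first by move=> x _; exact: dF.
  + by apply: cvg_at_right_filter; exact: cF.
  + by apply: cvg_at_left_filter; exact: cF.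
- by move=> x _; rewrite derive1E.
Qed.

End VanishingIntegrals.

(** * Derivatives with compact support integrate to zero in the plane *)

Section PlanarIntegrals.
Context {R : realType}.

Definition box (M : R) : set (R * R) := [set` `[- M, M]] `*` [set` `[- M, M]].

Lemma measurable_box (M : R) : measurable (box M).
Proof. by apply: measurableX; exact: measurable_itv. Qed.

Lemma boxP (M : R) (p : R * R) : box M p <-> `|p| <= M.
Proof.
rewrite /box/= !in_itv/= -!ler_norml /Num.norm/= ge_max.
by split=> [[-> ->]|/andP[]].
Qed.

Lemma box_compact (M : R) : compact (box M).
Proof. by apply: compact_setX; exact: segment_compact. Qed.

Lemma box_finite (M : R) : (leb2 R (box M) < +oo)%E.
Proof.
rewrite /box product_measure1E ?measurable_itv//.
by rewrite /= !lebesgue_measure_itv/=; case: ifP => _; rewrite ?mule0 ?ltry// -EFinD -EFinM ltry.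
Qed.

Lemma bounded_sub_box (O : set (R * R)) : bounded_set O -> exists M, O `<=` box M.
Proof.
move=> [M0 [_ HM]]; exists (M0 + 1) => p Op; apply/boxP.
by apply: HM Op; rewrite ltrDl.
Qed.

Lemma bounded_finite_measure (O : set (R * R)) : measurable O -> bounded_set O ->
  (leb2 R O < +oo)%E.
Proof.
move=> mO /bounded_sub_box[M OM]; apply: le_lt_trans (box_finite M).
by apply: le_measure => //; rewrite inE//; exact: measurable_box.
Qed.

Lemma continuous_bounded_on_compact (V : normedModType R) (K : set V) (f : V -> R) :
  compact K -> continuous f -> exists2 B, 0 < B & forall p, K p -> `|f p| <= B.
Proof.
move=> cK cf.
have : compact (f @` K) by apply: continuous_compact => //; exact: continuous_subspaceT.
move=> /bounded_support[B B0 HB]; exists B => // p Kp; apply: HB; by exists p.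
Qed.

Lemma integrable_continuous_box (G : R * R -> R) (M : R) : continuous G ->
  (forall p, M < `|p| -> G p = 0) -> (leb2 R).-integrable setT (EFin \o G).
Proof.
move=> cG G0.
have [B B0 HB] := continuous_bounded_on_compact (@box_compact M) cG.
have -> : EFin \o G = (EFin \o G) \_ (box M).
  apply/funext => p; rewrite patchE; case: ifPn => // /negP nI /=.
  by rewrite G0// ltNge; apply/negP => /boxP; move=> /mem_set.
have mB : measurable (box M) := @measurable_box M.
suff : (leb2 R).-integrable (box M) (EFin \o G).
  by move/(@integrable_mkcond _ _ R (leb2 R) (box M) (EFin \o G) mB).1.
apply: (@le_integrable _ _ R (leb2 R) (box M) mB _ (cst B%:E)).
- by apply/measurable_EFinP; exact: continuous_measurable_plane.
- by move=> p /HB; rewrite /= lee_fin (gtr0_norm B0).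
apply/integrableP; split; first exact: measurable_cst.
rewrite integral_cst//.
by rewrite lte_mul_pinfty ?box_finite// lee_fin ltW.
Qed.

(** The difference quotients of the slice and of [F] are the same function. *)
Lemma derive_slice_x (F : R * R -> R) (y x : R) :
  'D_1 (fun t => F (t, y)) x = 'D_(1, 0) F (x, y) /\
  (derivable F (x, y) (1, 0) -> derivable (fun t => F (t, y)) x 1).
Proof.
rewrite /derive /derivable.
have -> : (fun h : R => h^-1 *: (((fun t => F (t, y)) \o shift x) (h *: (1 : R)) - F (x, y)))
  = (fun h => h^-1 *: ((F \o shift (x, y)) (h *: ((1, 0) : R * R)) - F (x, y))).
  apply/funext => h /=; congr (_ *: (F _ - _)).
  by rewrite /shift/=; congr pair; rewrite /= scaler0 add0r.
by [].
Qed.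

Lemma derive_slice_y (F : R * R -> R) (x y : R) :
  'D_1 (fun t => F (x, t)) y = 'D_(0, 1) F (x, y) /\
  (derivable F (x, y) (0, 1) -> derivable (fun t => F (x, t)) y 1).
Proof.
rewrite /derive /derivable.
have -> : (fun h : R => h^-1 *: (((fun t => F (x, t)) \o shift y) (h *: (1 : R)) - F (x, y)))
  = (fun h => h^-1 *: ((F \o shift (x, y)) (h *: ((0, 1) : R * R)) - F (x, y))).
  apply/funext => h /=; congr (_ *: (F _ - _)).
  by rewrite /shift/=; congr pair; rewrite /= scaler0 add0r.
by [].
Qed.

Lemma slice_x_continuous (G : R * R -> R) (y : R) : continuous G ->
  continuous (fun t => G (t, y)).
Proof.
move=> cG t; apply: (@continuous_comp _ _ _ (fun t => (t, y)) G); last exact: cG.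
have h2 : (fun=> y) @ t --> y; first by exact: cvg_cst.
have h1 : (fun t : R => t) @ t --> t := cvg_id.
exact: cvg_pair h1 h2.
Qed.

Lemma slice_y_continuous (G : R * R -> R) (x : R) : continuous G ->
  continuous (fun t => G (x, t)).
Proof.
move=> cG t; apply: (@continuous_comp _ _ _ (fun t => (x, t)) G); last exact: cG.
have h1 : (fun=> x) @ t --> x; first by exact: cvg_cst.
have h2 : (fun t : R => t) @ t --> t := cvg_id.
exact: cvg_pair h1 h2.
Qed.

Lemma plane_norm_open (M : R) : open [set p : R * R | M < `|p|].
Proof.
apply: (@open_comp _ _ (fun x : R * R => `|x|) [set x | M < x]); last exact: open_gt.
by move=> y _; exact: norm_continuous.
Qed.

(** Fubini reduces the planar statement to the fundamental theorem of calculus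
  on each line parallel to the axis. *)
Lemma integral_partial_eq0 (e : R * R) (F : R * R -> R) (M : R) :
  e = dir_x \/ e = dir_y -> 0 < M -> C1_along e F ->
  (forall p, M < `|p| -> F p = 0) ->
  (\int[leb2 R]_p ('D_e F p)%:E = 0)%E.
Proof.
move=> he M0 [cF dF cdF] F0.
have iD : (leb2 R).-integrable setT (EFin \o 'D_e F).
  apply: (@integrable_continuous_box _ M) => // p Mp.
  by apply: (@derive_eq0_open R _ [set p : R * R | M < `|p|] e F) => //; exact: plane_norm_open.
have norm1 (x y : R) : `|x| <= `|(x, y)| by rewrite [leRHS]/Num.norm/= le_max lexx.
have norm2 (x y : R) : `|y| <= `|(x, y)| by rewrite [leRHS]/Num.norm/= le_max lexx orbT.
case: he => ?; subst e.
- rewrite -(integral21_prod_meas1 iD) /fubini_G.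
  rewrite -[RHS](integral0 (leb1 R) setT); apply: eq_integral => y _ /=.
  transitivity (\int[leb1 R]_x ('D_(1 : R) (fun t : R => F (t, y)) (x : R))%:E)%E.
    by apply: eq_integral => x _; rewrite (derive_slice_x F y x).1.
  apply: (@integral_derive1_eq0 R (fun t : R => F (t, y : R)) M M0).
    split; first exact: (@slice_x_continuous F y cF).
      by move=> x; apply: (derive_slice_x F y x).2; exact: dF.
    rewrite (_ : 'D_(1 : R) (fun t : R => F (t, y : R)) = fun t => 'D_dir_x F (t, y));
      first exact: (@slice_x_continuous ('D_dir_x F) y cdF).
    by apply/funext => x; rewrite (derive_slice_x F y x).1.
  by move=> x Mx; apply: F0; exact: lt_le_trans (norm1 x y).
- rewrite -(integral12_prod_meas1 iD) /fubini_F.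
  rewrite -[RHS](integral0 (leb1 R) setT); apply: eq_integral => x _ /=.
  transitivity (\int[leb1 R]_y ('D_(1 : R) (fun t : R => F (x, t)) (y : R))%:E)%E.
    by apply: eq_integral => y _; rewrite (derive_slice_y F x y).1.
  apply: (@integral_derive1_eq0 R (fun t : R => F (x : R, t)) M M0).
    split; first exact: (@slice_y_continuous F x cF).
      by move=> y; apply: (derive_slice_y F x y).2; exact: dF.
    rewrite (_ : 'D_(1 : R) (fun t : R => F (x : R, t)) = fun t => 'D_dir_y F (x, t));
      first exact: (@slice_y_continuous ('D_dir_y F) x cdF).
    by apply/funext => y; rewrite (derive_slice_y F x y).1.
  by move=> y My; apply: F0; exact: lt_le_trans (norm2 x y).
Qed.

End PlanarIntegrals.

(** * Integration by parts and C^1 elements of H^1 *)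

Section ComplexC1.
Context {R : realType} {V : normedModType R}.
Implicit Types (e : V) (v : V -> R[i]).

Definition cC1_along e v := C1_along e (ReF v) /\ C1_along e (ImF v).

Lemma test_function_C1 (O : set V) (phi : V -> R[i]) e :
  test_function O phi -> cC1_along e phi.
Proof.
move=> [sr si _]; split; split.
- exact: (sr [::]).1.
- by move=> x; exact: (sr [::]).2.
- exact: (sr [:: e]).1.
- exact: (si [::]).1.
- by move=> x; exact: (si [::]).2.
- exact: (si [:: e]).1.
Qed.

(** The complement of a compact set is open, and a function that vanishes on an
  open set has zero derivatives there. *)
Lemma derive_off_compact (K : set V) e (F : V -> R) : compact K ->
  (forall x, ~ K x -> F x = 0) -> forall x, ~ K x -> 'D_e F x = 0.
Proof.
move=> cK F0 x Kx; apply: (@derive_eq0_open R V (~` K) e F) => //.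
by apply: closed_openC; apply: compact_closed => //; exact: norm_hausdorff.
Qed.

Lemma cderive_off_compact (K : set V) e v : compact K ->
  (forall x, ~ K x -> v x = 0) -> forall x, ~ K x -> cderive e v x = 0.
Proof.
move=> cK v0 x Kx; rewrite /cderive !(@derive_off_compact K)// => y Ky;
  by rewrite /ReF /ImF v0.
Qed.

Lemma test_function_cderive (O : set V) e phi :
  test_function O phi -> test_function O (cderive e phi).
Proof.
move=> [sr si [K [cK KO K0]]]; split.
- by move=> vs; have := sr (rcons vs e); rewrite /iter_derive foldr_rcons.
- by move=> vs; have := si (rcons vs e); rewrite /iter_derive foldr_rcons.
- exists K; split => // x; exact: cderive_off_compact.
Qed.

Lemma C1_alongN e (F : V -> R) : C1_along e F -> C1_along e (- F).
Proof.
move=> [cF dF cdF]; split.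
- by move=> x; apply: cvgN; exact: cF.
- by move=> x; exact: derivableN.
- rewrite (_ : 'D_e (- F) = - 'D_e F); last by apply/funext => x; rewrite deriveN.
  by move=> x; apply: cvgN; exact: cdF.
Qed.

Lemma cC1_conj e v : cC1_along e v -> cC1_along e (conjF v).
Proof.
move=> [rv iv]; split; first by rewrite ReF_conj.
by rewrite ImF_conj; exact: C1_alongN.
Qed.

Lemma cderive_conj e v : cC1_along e v -> cderive e (conjF v) = conjF (cderive e v).
Proof.
move=> [_ [_ dv _]]; apply/funext => x; rewrite /cderive /conjF/=.
by rewrite ReF_conj ImF_conj (_ : (fun x => - _) = - ImF v)// deriveN.
Qed.

End ComplexC1.

Section ByParts.
Context {R : realType} {d} {T : measurableType d}.
Variables (mu : {measure set T -> \bar R}) (D : set T).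
Hypothesis mD : measurable D.

(** The real building block of integration by parts: the complex identity is made
  of four of these, one for each pair of real and imaginary parts. Integrability
  is included because it is what allows the parts to be recombined. *)
Definition by_parts (v dv w dw : T -> R) :=
  [/\ mu.-integrable D (EFin \o (v \* dw)), mu.-integrable D (EFin \o (dv \* w)) &
   Rintegral mu D (v \* dw) = - Rintegral mu D (dv \* w)].

Lemma cint_by_parts (v dv w dw : T -> R[i]) :
  by_parts (ReF v) (ReF dv) (ReF w) (ReF dw) ->
  by_parts (ReF v) (ReF dv) (ImF w) (ImF dw) ->
  by_parts (ImF v) (ImF dv) (ReF w) (ReF dw) ->
  by_parts (ImF v) (ImF dv) (ImF w) (ImF dw) ->
  cint mu D (fun x => v x * dw x) = - cint mu D (fun x => dv x * w x).
Proof.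
move=> [a1 a2 a3] [b1 b2 b3] [c1 c2 c3] [d1 d2 d3].
rewrite /cint !ReF_mul !ImF_mul !RintegralB// !RintegralD//.
move: a3 b3 c3 d3 => /= -> -> -> ->.
by apply/eqP; rewrite eq_complex/=; apply/andP; split; apply/eqP; ring.
Qed.

Lemma by_parts_of_sum (v dv w dw : T -> R) :
  mu.-integrable D (EFin \o (v \* dw)) -> mu.-integrable D (EFin \o (dv \* w)) ->
  (\int[mu]_(x in D) (v x * dw x + w x * dv x)%:E = 0)%E -> by_parts v dv w dw.
Proof.
move=> i1 i2 i0; split => //; apply/eqP; rewrite -addr_eq0 -RintegralD//.
rewrite /Rintegral (_ : (fun x => _) = (fun x => (v x * dw x + w x * dv x)%:E)) ?i0//.
by apply/funext => x /=; rewrite [dv x * _]mulrC.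
Qed.

Lemma integral_support (K : set T) (G : T -> R) : K `<=` D ->
  (forall x, ~ K x -> G x = 0) ->
  (\int[mu]_(x in D) (G x)%:E = \int[mu]_x (G x)%:E)%E.
Proof.
move=> KD G0; rewrite integral_mkcond; apply: eq_integral => x _.
rewrite patchE; case: ifPn => // /negP nD; rewrite G0// => /KD Dx.
by apply: nD; exact/mem_set.
Qed.

End ByParts.

Section ByPartsLebesgue.
Context {R : realType}.

Lemma by_parts_plane (O K : set (R * R)) (e : R * R) (v w : R * R -> R) :
  e = dir_x \/ e = dir_y -> measurable O -> compact K -> K `<=` O ->
  C1_along e v -> C1_along e w -> (forall p, ~ K p -> w p = 0) ->
  by_parts (leb2 R) O v ('D_e v) w ('D_e w).
Proof.
move=> he mO cK KO Cv Cw w0.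
have [M M0 KM] := bounded_support cK.
have notK p : M < `|p| -> ~ K p by move=> Mp /KM; rewrite leNgt Mp.
have dw0 : forall p, ~ K p -> 'D_e w p = 0 by exact: derive_off_compact.
have vw0 p : ~ K p -> (v * w) p = 0 by move=> Kp; rewrite /= /GRing.mul/= w0// mulr0.
have [cv _ cdv] := Cv; have [cw _ cdw] := Cw.
apply: by_parts_of_sum => //.
- apply: (@integrableS _ _ R (leb2 R) setT) => //.
  apply: (@integrable_continuous_box _ _ M).
    by move=> p; apply: cvgM; [exact: cv|exact: cdw].
  by move=> p /notK Kp; rewrite /= dw0// mulr0.
- apply: (@integrableS _ _ R (leb2 R) setT) => //.
  apply: (@integrable_continuous_box _ _ M).
    by move=> p; apply: cvgM; [exact: cdv|exact: cw].
  by move=> p /notK Kp; rewrite /= w0// mulr0.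
have [_ dv _] := Cv; have [_ dw _] := Cw.
have DE p : v p * 'D_e w p + w p * 'D_e v p = 'D_e (v * w) p.
  by rewrite deriveM.
rewrite (@integral_support _ _ _ (leb2 R) O K)//; last first.
  by move=> p Kp; rewrite dw0// w0// mulr0 mul0r addr0.
under eq_integral do rewrite DE.
apply: (integral_partial_eq0 he M0); first exact: C1_alongM.
by move=> p /notK; exact: vw0.
Qed.

Lemma integrable_continuous_line (G : R -> R) (M : R) : continuous G ->
  (forall p, M < `|p| -> G p = 0) -> (leb1 R).-integrable setT (EFin \o G).
Proof.
move=> cG G0.
pose I : set R := [set` `[- M, M]].
have -> : EFin \o G = (EFin \o G) \_ I.
  apply/funext => p; rewrite patchE; case: ifPn => // /negP nI /=.
  rewrite G0// ltNge; apply/negP => pM; apply: nI; apply/mem_set.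
  by rewrite /I/= in_itv/= -ler_norml.
have mI : measurable I by exact: measurable_itv.
apply/(@integrable_mkcond _ _ R (leb1 R) I (EFin \o G) mI).1.
apply: continuous_compact_integrable; first exact: segment_compact.
exact: continuous_subspaceT.
Qed.

Lemma by_parts_line (O K : set R) (v w : R -> R) :
  measurable O -> compact K -> K `<=` O ->
  C1_along (1 : R) v -> C1_along (1 : R) w -> (forall p, ~ K p -> w p = 0) ->
  by_parts (leb1 R) O v ('D_(1 : R) v) w ('D_(1 : R) w).
Proof.
move=> mO cK KO Cv Cw w0.
have [M M0 KM] := bounded_support cK.
have notK p : M < `|p| -> ~ K p by move=> Mp /KM; rewrite leNgt Mp.
have dw0 : forall p, ~ K p -> 'D_(1 : R) w p = 0 by exact: derive_off_compact.
have vw0 p : ~ K p -> (v * w) p = 0 by move=> Kp; rewrite /= /GRing.mul/= w0// mulr0.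
have [cv _ cdv] := Cv; have [cw _ cdw] := Cw.
apply: by_parts_of_sum => //.
- apply: (@integrableS _ _ R (leb1 R) setT) => //.
  apply: (@integrable_continuous_line _ M).
    by move=> p; apply: cvgM; [exact: cv|exact: cdw].
  by move=> p /notK Kp; rewrite /= dw0// mulr0.
- apply: (@integrableS _ _ R (leb1 R) setT) => //.
  apply: (@integrable_continuous_line _ M).
    by move=> p; apply: cvgM; [exact: cdv|exact: cw].
  by move=> p /notK Kp; rewrite /= w0// mulr0.
have [_ dv _] := Cv; have [_ dw _] := Cw.
have DE (p : R) : v p * 'D_(1 : R) w p + w p * 'D_(1 : R) v p = 'D_(1 : R) (v * w) p.
  by rewrite deriveM.
rewrite (@integral_support _ _ _ (leb1 R) O K)//; last first.
  by move=> p Kp; rewrite dw0// w0// mulr0 mul0r addr0.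
under eq_integral do rewrite DE.
apply: (integral_derive1_eq0 M0); first exact: C1_alongM.
by move=> p /notK; exact: vw0.
Qed.

(** The product of [v] with a test function has compact support in [O], so the
  integral of its derivative vanishes. *)
Lemma weak_deriv_C1 (O : set (R * R)) (e : R * R) (v : R * R -> R[i]) :
  open O -> e = dir_x \/ e = dir_y -> cC1_along e v ->
  weak_deriv O e v (cderive e v).
Proof.
move=> oO he [rv iv] phi /[dup] /(test_function_C1 e)[rp ip] [_ _ [K [cK KO K0]]].
have mO := open_measurable_plane oO.
have r0 p : ~ K p -> ReF phi p = 0 by move=> /K0; rewrite /ReF => ->.
have i0 p : ~ K p -> ImF phi p = 0 by move=> /K0; rewrite /ImF => ->.
apply: (@cint_by_parts _ _ _ (leb2 R) O mO v (cderive e v) phi (cderive e phi)).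
- exact: (by_parts_plane he mO cK KO rv rp r0).
- exact: (by_parts_plane he mO cK KO rv ip i0).
- exact: (by_parts_plane he mO cK KO iv rp r0).
- exact: (by_parts_plane he mO cK KO iv ip i0).
Qed.

Lemma is_distr_dx_C1 (I : set R) (q : R -> R[i]) : open I ->
  cC1_along (1 : R) q -> is_distr_dx I q (cderive (1 : R) q).
Proof.
move=> oI [rv iv] phi /[dup] /(test_function_C1 (1 : R))[rp ip] [_ _ [K [cK KO K0]]].
have mI := open_measurable oI.
have r0 p : ~ K p -> ReF phi p = 0 by move=> /K0; rewrite /ReF => ->.
have i0 p : ~ K p -> ImF phi p = 0 by move=> /K0; rewrite /ImF => ->.
rewrite /distr_dx; apply: esym; apply/eqP; rewrite eqr_oppLR; apply/eqP.
apply: (@cint_by_parts _ _ _ (leb1 R) I mI q (cderive (1 : R) q) phi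
  (cderive (1 : R) phi)).
- exact: (by_parts_line mI cK KO rv rp r0).
- exact: (by_parts_line mI cK KO rv ip i0).
- exact: (by_parts_line mI cK KO iv rp r0).
- exact: (by_parts_line mI cK KO iv ip i0).
Qed.

Lemma L2_continuous_plane (O : set (R * R)) (v : R * R -> R[i]) :
  open O -> bounded_set O -> continuous (ReF v) -> continuous (ImF v) ->
  L2 (leb2 R) O v.
Proof.
move=> oO bO cr ci; have mO := open_measurable_plane oO.
have [M OM] := bounded_sub_box bO.
have [B1 _ H1] := continuous_bounded_on_compact (@box_compact R M) cr.
have [B2 _ H2] := continuous_bounded_on_compact (@box_compact R M) ci.
apply: (@L2_bounded _ _ _ (leb2 R) O mO _ (B1 ^+ 2 + B2 ^+ 2)).
- exact: bounded_finite_measure.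
- by split; exact: continuous_measurable_plane.
by move=> p /OM Op; apply: sqmod_le; [exact: H1|exact: H2].
Qed.

Lemma test_function_L2 (O : set (R * R)) (phi : R * R -> R[i]) :
  open O -> bounded_set O -> test_function O phi -> L2 (leb2 R) O phi.
Proof.
move=> oO bO [sr si _].
by apply: L2_continuous_plane => //; [exact: (sr [::]).1|exact: (si [::]).1].
Qed.

Lemma L2_C1 (O : set (R * R)) (e : R * R) (v : R * R -> R[i]) :
  open O -> bounded_set O -> cC1_along e v ->
  L2 (leb2 R) O v /\ L2 (leb2 R) O (cderive e v).
Proof.
by move=> oO bO [[cr _ dr] [ci _ di]]; split; apply: L2_continuous_plane.
Qed.

Definition H1_of_C1 (O : set (R * R)) (v : R * R -> R[i])
    (oO : open O) (bO : bounded_set O)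
    (cx : cC1_along dir_x v) (cy : cC1_along dir_y v) : H1 O :=
  MkH1 (proj1 (L2_C1 oO bO cx)) (proj2 (L2_C1 oO bO cx)) (proj2 (L2_C1 oO bO cy))
    (weak_deriv_C1 oO (or_introl erefl) cx) (weak_deriv_C1 oO (or_intror erefl) cy).

End ByPartsLebesgue.

(** * The boundary near Gamma *)

Section FlatBoundary.
Context {R : realType}.
Variable O : set (R * R).
Hypothesis hlip : lipschitz_boundary O.
Hypothesis hGamma : forall x, Gamma x -> bdry O (x, 0).

Lemma GammaP (x : R) : Gamma x <-> `|x| < 1.
Proof. by rewrite /Gamma/= in_itv/= ltr_norml. Qed.

Lemma linear_form_cvg0 (x0 k l : R) :
  (fun z : R * R => (z.1 - x0) * k + z.2 * l) z @[z --> (x0, 0 : R)] --> (0 : R).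
Proof.
have {2}-> : (0 : R) = (x0 - x0) * k + 0 * l by ring.
apply: cvgD; apply: cvgM; [|exact: cvg_cst| |exact: cvg_cst].
- by apply: cvgB; [exact: cvg_fst|exact: cvg_cst].
- exact: cvg_snd.
Qed.

Lemma linear_form_near (x0 k l e : R) : 0 < e ->
  \forall z \near (x0, 0 : R), `|(z.1 - x0) * k + z.2 * l| < e.
Proof. by move=> e0; have /cvgr0_norm_lt := @linear_form_cvg0 x0 k l; exact. Qed.

(** In a chart at a point of [Gamma] the boundary is a graph over the first chart
  coordinate [s]. The segment [Gamma] cannot be vertical in that chart, so it
  already covers all small values of [s], and the graph has no room for any other
  point of the boundary. *)
Lemma bdry_flat_near (x0 : R) : Gamma x0 ->
  \forall z \near (x0, 0 : R), bdry O z -> z.2 = 0.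
Proof.
move=> Gx0; have [[p a b r d h] /= [-> [/= ab [r0 d0] _ hd hO]]] := hlip (hGamma Gx0).
rewrite /chart_dom/= /chart_pt/= in hd hO.
have /GammaP Gx0' := Gx0.
have domP s : `|s| < r -> s \in `]- r, r[ by rewrite in_itv/= ltr_norml.
(* With [a = 0] the segment is vertical in the chart: its points other than the
  centre lie above [s = 0] too, against the graph property. *)
have a0 : a != 0.
  apply/eqP => a0; subst a.
  have b1 : `|b| = 1.
    by apply/eqP; rewrite -sqrp_eq1 ?normr_ge0// real_normK ?num_real//; apply/eqP; lra.
  have h0 : 0 = h 0.
    apply/(hO 0 0 (domP 0 _) _).2; rewrite ?normr0//.
    by rewrite !(mul0r, mulr0, addr0, subr0, add0r); exact: hGamma.
  pose m := Num.min d (1 - `|x0|).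
  have m0 : 0 < m by rewrite lt_min d0 subr_gt0.
  have md : m <= d by rewrite ge_min lexx.
  have mx : m <= 1 - `|x0| by rewrite ge_min lexx orbT.
  have nt : `|- (m / 2) * b| < d.
    by rewrite normrM normrN b1 mulr1 gtr0_norm; lra.
  have := (hO 0 (- (m / 2) * b) (domP 0 _) nt).2; rewrite normr0 => /(_ r0).
  rewrite !(mul0r, mulr0, addr0, subr0, add0r) -h0 => -[+ _].
  have -> : x0 - - (m / 2) * b * b = x0 + m / 2 * (0 ^+ 2 + b ^+ 2) by ring.
  rewrite ab mulr1 => /(_ _)/eqP; rewrite mulf_eq0 => H.
  have : (- (m / 2) == 0) || (b == 0).
    apply: H; apply: hGamma; apply/GammaP.
    by rewrite (le_lt_trans (ler_normD _ _))// [X in _ + X]gtr0_norm; lra.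
  move=> /orP[/eqP|/eqP b0]; first by lra.
  by move: b1; rewrite b0 normr0; lra.
have e1 : 0 < 1 - `|x0| by rewrite subr_gt0.
near=> z.
(* [s] and [t] are the chart coordinates of [z]. The point of [Gamma] above the
  same [s] has abscissa [x0 + tau] and second chart coordinate [- (tau * b)]. *)
have sr : `|(z.1 - x0) * a + z.2 * b| < r by near: z; exact: linear_form_near.
have td : `|(z.1 - x0) * (- b) + z.2 * a| < d by near: z; exact: linear_form_near.
have tx : `|(z.1 - x0) * 1 + z.2 * (b / a)| < 1 - `|x0|.
  by near: z; exact: linear_form_near.
have tbd : `|(z.1 - x0) * b + z.2 * (b / a * b)| < d.
  by near: z; exact: linear_form_near.
set s := (X in `|X| < r) in sr.
set t := (X in `|X| < d) in td.
set tau := (X in `|X| < 1 - _) in tx.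
have {}tbd : `|- (tau * b)| < d.
  by rewrite normrN (_ : tau * b = (z.1 - x0) * b + z.2 * (b / a * b))// /tau; ring.
move=> bz.
have sE : s = tau * a by rewrite /s /tau; field.
have th : t = h s.
  apply/(hO s t (domP _ sr) td).2.
  have -> : x0 + s * a - t * b = x0 + (z.1 - x0) * (a ^+ 2 + b ^+ 2) by rewrite /s /t; ring.
  have -> : 0 + s * b + t * a = z.2 * (a ^+ 2 + b ^+ 2) by rewrite /s /t; ring.
  by rewrite ab !mulr1 subrKC; case: (z) bz.
have tauh : - (tau * b) = h s.
  apply/(hO s (- (tau * b)) (domP _ sr) tbd).2.
  have -> : x0 + s * a - - (tau * b) * b = x0 + tau * (a ^+ 2 + b ^+ 2) by rewrite sE; ring.
  have -> : 0 + s * b + - (tau * b) * a = 0 by rewrite sE; ring.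
  rewrite ab mulr1; apply: hGamma; apply/GammaP.
  by rewrite (le_lt_trans (ler_normD _ _))//; lra.
have : t + tau * b = 0 by rewrite th -tauh; ring.
have -> : t + tau * b = z.2 * (a ^+ 2 + b ^+ 2) / a by rewrite /t /tau; field.
rewrite ab mulr1 => /eqP; rewrite mulf_eq0 invr_eq0 (negbTE a0) orbF.
by move/eqP.
Unshelve. all: by end_near. Qed.

(** By compactness, the neighbourhoods of [bdry_flat_near] contain a strip of
  uniform height around [K]. *)
Lemma bdry_flat_compact (K : set R) : compact K -> K `<=` Gamma ->
  exists2 e : R, 0 < e &
    forall x y, K x -> `|y| < e -> bdry O (x, y) -> y = 0.
Proof.
move=> /compact_near_coveringP cK KG.
have : \forall e \near (0 : R)^'+, K `<=` (fun x => forall y, `|y| < e -> bdry O (x, y) -> y = 0).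
  apply: cK => x /KG /bdry_flat_near.
  move=> [[U V]/= [Ux /= V0] UV].
  have [e /= e0 eV] : exists2 e : R, 0 < e & forall y, `|y| < e -> V y.
    move: V0 => [e /= e0 eV]; exists e => // y ye; apply: eV => /=.
    by rewrite sub0r normrN.
  exists (U, [set r | r < e]) => /=.
    split => //; exact: nbhs_right_lt.
  move=> [x' r]/= [Ux' re] y yr bxy.
  apply: (UV (x', y)) => //=; split => //=; apply: eV; exact: lt_trans re.
move=> H; have : \forall e \near (0 : R)^'+, 0 < e /\
    (K `<=` (fun x => forall y, `|y| < e -> bdry O (x, y) -> y = 0)).
  near=> e; split; first by near: e; exact: nbhs_right_gt.
  by near: e.
move=> /filter_ex[e [e0 He]]; exists e => // x y Kx; exact: (He x Kx y).
Unshelve. all: by end_near. Qed.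

End FlatBoundary.

(** * Cutoff functions *)

Section Cutoff.
Context {R : realType}.

(** Squaring the positive part removes its kink: the derivative is twice the
  positive part, which is continuous. *)
Definition pos_sqr (t : R) : R := (Num.max 0 t) ^+ 2.

Lemma is_derive_pos_sqr (t : R) : is_derive t (1 : R) pos_sqr (2 * Num.max 0 t).
Proof.
have [t0|t0|->] := ltgtP t 0.
- rewrite mulr0.
  apply: (@near_eq_is_derive _ _ _ (cst 0)).
  near=> x; rewrite /pos_sqr max_l ?expr0n//.
  by apply/ltW; near: x; exact: lt_nbhsl.
- apply: (@near_eq_is_derive R R R (fun x : R => x ^+ 2)).
    near=> x; rewrite /pos_sqr max_r//.
    by apply/ltW; near: x; exact: lt_nbhsr.
  have := @is_deriveX _ _ id 2 t 1 1 (is_derive_id _ _).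
  by rewrite /= expr1 /GRing.scale/= mulr1.
rewrite mulr0.
have H : (fun h : R => h^-1 *: ((pos_sqr \o shift 0) (h *: (1 : R)) - pos_sqr 0)) @ 0^' --> (0 : R).
  apply/cvgr0Pnorm_lt => e e0; near=> h.
  rewrite /pos_sqr/= addr0 maxxx expr0n/= subr0 /GRing.scale/= mulr1.
  have he : `|h| < e.
    near: h; exact: dnbhs0_lt.
  have h0 : h != 0 by near: h; exact: nbhs_dnbhs_neq.
  apply: le_lt_trans he.
  have [hn|hp] := ltP 0 h.
    by rewrite expr2 mulrA mulVf// mul1r.
  by rewrite expr0n/= mulr0 normr0.
by apply: DeriveDef; [apply/cvg_ex; exists 0|apply: cvg_lim].
Unshelve. all: by end_near. Qed.

Definition cutoff (e y : R) : R := pos_sqr (1 - (y / e) ^+ 2).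

Lemma cutoff0 (e : R) : cutoff e 0 = 1.
Proof. by rewrite /cutoff /pos_sqr mul0r expr0n/= subr0 max_r ?expr1n. Qed.

Lemma cutoff_eq0 (e y : R) : 0 < e -> e <= `|y| -> cutoff e y = 0.
Proof.
move=> e0 ey; rewrite /cutoff /pos_sqr max_l ?expr0n// subr_le0.
rewrite -real_normK ?num_real// normrM normfV (gtr0_norm e0).
by rewrite expr_ge1 ?divr_ge0 ?(ltW e0)// ler_pdivlMr// mul1r.
Qed.

Lemma max0_continuous : continuous (fun t : R => Num.max 0 t).
Proof. by move=> t; apply: (@continuous_max _ _ (cst 0) id); [exact: cvg_cst|exact: cvg_id]. Qed.

Lemma is_derive_cutoff (e y : R) : is_derive y (1 : R) (cutoff e)
  (2 * Num.max 0 (1 - (y / e) ^+ 2) * (- (2 * y / e ^+ 2))).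
Proof.
have Hg : is_derive y (1 : R) (fun y => 1 - (y / e) ^+ 2) (- (2 * y / e ^+ 2)).
  have -> : (fun y : R => 1 - (y / e) ^+ 2) = cst 1 - (e ^- 2) \*: (fun y : R => y ^+ 2).
    apply/funext => x; rewrite /GRing.add/= /GRing.opp/= /GRing.scale/=.
    by rewrite exprMn exprVn mulrC.
  have := is_deriveB (@is_derive_cst _ _ R 1 y 1)
     (is_deriveZ (e ^- 2) (@is_deriveX _ _ id 2 y 1 1 (is_derive_id _ _))).
  by rewrite /= expr1 sub0r /GRing.scale/= mulr1 [e ^- 2 * _]mulrC.
exact: (is_derive1_comp (is_derive_pos_sqr _) Hg).
Qed.

Lemma C1_cutoff (e : R) : C1_along (1 : R) (cutoff e).
Proof.
have dc (y : R) : derivable (cutoff e) y 1 by case: (is_derive_cutoff e y).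
split => //.
- by move=> y; apply/differentiable_continuous/derivable1_diffP.
- have -> : 'D_(1 : R) (cutoff e) =
      (fun y => 2 * Num.max 0 (1 - (y / e) ^+ 2) * (- (2 * y / e ^+ 2))).
    by apply/funext => y; case: (is_derive_cutoff e y).
  have cg : continuous (fun y : R => 1 - (y / e) ^+ 2).
    move=> y; apply: cvgB; first exact: cvg_cst.
    by rewrite expr2; under eq_fun do rewrite expr2; apply: cvgM;
      apply: cvgM; [exact: cvg_id|exact: cvg_cst|exact: cvg_id|exact: cvg_cst].
  move=> y; apply: cvgM.
    apply: cvgM; first exact: cvg_cst.
    exact: (continuous_comp (cg y) (@max0_continuous _)).
  apply: cvgN; apply: cvgM; last exact: cvg_cst.
  by apply: cvgM; [exact: cvg_cst|exact: cvg_id].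
Qed.

Lemma C1_fst (f : R -> R) : C1_along (1 : R) f ->
  C1_along dir_x (fun p : R * R => f p.1) /\ C1_along dir_y (fun p : R * R => f p.1).
Proof.
move=> [cf df cdf].
have cc (g : R -> R) : continuous g -> continuous (fun p : R * R => g p.1).
  by move=> cg p; apply: (@continuous_comp _ _ _ fst g); [exact: cvg_fst|exact: cg].
have Ex p : (fun h : R => h^-1 *: (((fun p : R * R => f p.1) \o shift p) (h *: dir_x) - f p.1)) =
    (fun h : R => h^-1 *: ((f \o shift p.1) (h *: (1 : R)) - f p.1)) by [].
have Ey p : (fun h : R => h^-1 *: (((fun p : R * R => f p.1) \o shift p) (h *: dir_y) - f p.1)) =
    cst (0 : R).
  by apply/funext => h /=; rewrite scaler0 add0r subrr scaler0.
split; split.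
- exact: (cc _ cf).
- by move=> p; rewrite /derivable Ex; exact: df.
- have -> : 'D_dir_x (fun p : R * R => f p.1) = (fun p => 'D_(1 : R) f p.1).
    by apply/funext => p; rewrite /derive Ex.
  exact: (cc _ cdf).
- exact: (cc _ cf).
- by move=> p; rewrite /derivable Ey; apply: is_cvg_cst.
- have -> : 'D_dir_y (fun p : R * R => f p.1) = cst 0.
    by apply/funext => p; rewrite /derive Ey; exact: lim_cst.
  by move=> p; exact: cvg_cst.
Qed.

Lemma C1_snd (f : R -> R) : C1_along (1 : R) f ->
  C1_along dir_x (fun p : R * R => f p.2) /\ C1_along dir_y (fun p : R * R => f p.2).
Proof.
move=> [cf df cdf].
have cc (g : R -> R) : continuous g -> continuous (fun p : R * R => g p.2).
  by move=> cg p; apply: (@continuous_comp _ _ _ snd g); [exact: cvg_snd|exact: cg].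
have Ey p : (fun h : R => h^-1 *: (((fun p : R * R => f p.2) \o shift p) (h *: dir_y) - f p.2)) =
    (fun h : R => h^-1 *: ((f \o shift p.2) (h *: (1 : R)) - f p.2)) by [].
have Ex p : (fun h : R => h^-1 *: (((fun p : R * R => f p.2) \o shift p) (h *: dir_x) - f p.2)) =
    cst (0 : R).
  by apply/funext => h /=; rewrite scaler0 add0r subrr scaler0.
split; split.
- exact: (cc _ cf).
- by move=> p; rewrite /derivable Ex; apply: is_cvg_cst.
- have -> : 'D_dir_x (fun p : R * R => f p.2) = cst 0.
    by apply/funext => p; rewrite /derive Ex; exact: lim_cst.
  by move=> p; exact: cvg_cst.
- exact: (cc _ cf).
- by move=> p; rewrite /derivable Ey; exact: df.
- have -> : 'D_dir_y (fun p : R * R => f p.2) = (fun p => 'D_(1 : R) f p.2).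
    by apply/funext => p; rewrite /derive Ey.
  exact: (cc _ cdf).
Qed.

(** On the boundary this is [psi] extended by zero, once [e] is the height given by
  [bdry_flat_compact] for the support of [psi]. *)
Definition lift (e : R) (psi : R -> R[i]) (p : R * R) : R[i] :=
  psi p.1 * (cutoff e p.2)%:C.

Lemma cC1_lift (e : R) (psi : R -> R[i]) : cC1_along (1 : R) psi ->
  cC1_along dir_x (lift e psi) /\ cC1_along dir_y (lift e psi).
Proof.
move=> [rp ip].
have rE : ReF (lift e psi) = (fun p : R * R => ReF psi p.1) * (fun p => cutoff e p.2).
  apply/funext => p; rewrite /ReF /lift [RHS]/GRing.mul/=.
  by case: (psi p.1) => a b /=; rewrite mulr0 subr0.
have iE : ImF (lift e psi) = (fun p : R * R => ImF psi p.1) * (fun p => cutoff e p.2).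
  apply/funext => p; rewrite /ImF /lift [RHS]/GRing.mul/=.
  by case: (psi p.1) => a b /=; rewrite mulr0 add0r.
have [rx ry] := C1_fst rp; have [ix iy] := C1_fst ip.
have [cx cy] := C1_snd (C1_cutoff e).
split; split.
- by rewrite rE; exact: (C1_alongM rx cx).
- by rewrite iE; exact: (C1_alongM ix cx).
- by rewrite rE; exact: (C1_alongM ry cy).
- by rewrite iE; exact: (C1_alongM iy cy).
Qed.

End Cutoff.

(** * Differences and traces in H^1 *)

Section SobolevDifference.
Context {R : realType}.
Variable O : set (R * R).
Hypotheses (oO : open O) (bO : bounded_set O).

Lemma weak_deriv_sub e (u1 u2 g1 g2 : R * R -> R[i]) :
  L2 (leb2 R) O u1 -> L2 (leb2 R) O u2 -> L2 (leb2 R) O g1 -> L2 (leb2 R) O g2 ->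
  weak_deriv O e u1 g1 -> weak_deriv O e u2 g2 ->
  weak_deriv O e (fun p => u1 p - u2 p) (fun p => g1 p - g2 p).
Proof.
move=> Lu1 Lu2 Lg1 Lg2 D1 D2 phi tphi.
have mO := open_measurable_plane oO.
have Lphi := test_function_L2 oO bO tphi.
have Ldphi := test_function_L2 oO bO (test_function_cderive e tphi).
have subE (a b c : R * R -> R[i]) : (fun p => (a p - b p) * c p) =
  (fun p => a p * c p - b p * c p) by apply/funext => p; rewrite mulrBl.
rewrite !subE (@cintB _ _ _ (leb2 R) O mO); [|exact: L2_mul_integrable..].
rewrite (@cintB _ _ _ (leb2 R) O mO); [|exact: L2_mul_integrable..].
by rewrite D1// D2// opprB addrC opprK.
Qed.

Definition H1_sub (u v : H1 O) : H1 O :=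
  let L2B := @L2_sub _ _ _ (leb2 R) O (open_measurable_plane oO) in
  MkH1 (L2B _ _ (h1_L2 u) (h1_L2 v)) (L2B _ _ (h1_dx_L2 u) (h1_dx_L2 v))
    (L2B _ _ (h1_dy_L2 u) (h1_dy_L2 v))
    (weak_deriv_sub (h1_L2 u) (h1_L2 v) (h1_dx_L2 u) (h1_dx_L2 v) (h1_dxP u) (h1_dxP v))
    (weak_deriv_sub (h1_L2 u) (h1_L2 v) (h1_dy_L2 u) (h1_dy_L2 v) (h1_dyP u) (h1_dyP v)).

End SobolevDifference.

Section Traces.
Context {R : realType}.
Variable O : set (R * R).
Hypotheses (oO : open O) (bO : bounded_set O).

Lemma measurable_closure : measurable (closure O).
Proof.
rewrite -[closure O]setCK; apply: measurableC; apply: open_measurable_plane.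
exact/closed_openC/closed_closure.
Qed.

Lemma measurable_bdry : measurable (bdry O).
Proof.
apply: measurableD; first exact: measurable_closure.
apply: open_measurable_plane; exact: open_interior.
Qed.

Lemma lip_chart_continuous (c : chart) : lip_chart O c ->
  {in chart_dom c, continuous (ch_h c)}.
Proof.
move=> [_ _ [M0 [_ HM]] _ _] x /set_mem xD.
have [M M0M M1] : exists2 M, M0 < M & 0 < M.
  exists (Num.max M0 0 + 1); first by rewrite ltr_pwDr// le_max lexx.
  by rewrite ltr_wpDl// le_max lexx orbT.
have oD : nbhs x (chart_dom c).
  by apply: open_nbhs_nbhs; split => //; exact: interval_open.
apply/cvgrPdist_lt => e e0.
have xe : \forall y \near x, `|x - y| < e / M.
  have /cvgrPdist_lt : (fun y : R => y) @ x --> x by exact: cvg_id.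
  by apply; rewrite divr_gt0.
near=> y.
have := HM M M0M (x, y); rewrite /=.
have yD : chart_dom c y by near: y.
move=> /(_ (conj xD yD)) /le_lt_trans; apply.
rewrite -ltr_pdivlMl// mulrC.
by near: y; exact: xe.
Unshelve. all: by end_near. Qed.

Definition chart_graph (c : chart) (s : R) : R * R := chart_pt c s (ch_h c s).

Lemma measurable_chart_graph (c : chart) : lip_chart O c ->
  measurable_fun (chart_dom c) (chart_graph c).
Proof.
move=> hc.
have oD : open (chart_dom c) by exact: interval_open.
have mD : measurable (chart_dom c) by exact: open_measurable.
have mh : measurable_fun (chart_dom c) (ch_h c).
  by apply: open_continuous_measurable_fun => //; exact: lip_chart_continuous.
(* Extending the chart function by zero makes the pair measurable on the whole line. *)
have mh' : measurable_fun setT (ch_h c \_ (chart_dom c)).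
  exact/(measurable_restrictT _ mD).
apply: (@eq_measurable_fun _ _ _ _ _ (fun s => chart_pt c s ((ch_h c \_ (chart_dom c)) s))).
  by move=> s sD; rewrite /chart_graph patchE sD.
apply: (@measurable_funS _ _ _ _ setT) => //.
apply: measurable_fun_pair.
- apply: measurable_funB; last exact: measurable_funM.
  by apply: measurable_funD => //; exact: measurable_funM.
- apply: measurable_funD; last exact: measurable_funM.
  by apply: measurable_funD => //; exact: measurable_funM.
Qed.

Lemma chart_graph_bdry (c : chart) s : lip_chart O c -> chart_dom c s ->
  bdry O (chart_graph c s).
Proof. by move=> [_ _ _ hd hO] sD; apply/(hO s _ sD _).2 => //; exact: hd. Qed.

Lemma cmeasurable_chart (c : chart) (g : R * R -> R[i]) : lip_chart O c ->
  cmeasurable (bdry O) g -> cmeasurable (chart_dom c) (g \o chart_graph c).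
Proof.
move=> hc [rg ig].
have sub : [set chart_graph c s | s in chart_dom c] `<=` bdry O.
  by move=> _ [s sD <-]; exact: chart_graph_bdry.
by split; [apply: (measurable_comp measurable_bdry sub rg)|
  apply: (measurable_comp measurable_bdry sub ig)]; exact: measurable_chart_graph.
Qed.

Lemma cmeasurable_bdry_continuous (f : R * R -> R[i]) :
  {within closure O, continuous (ReF f)} -> {within closure O, continuous (ImF f)} ->
  cmeasurable (bdry O) f.
Proof.
have sub : bdry O `<=` closure O by move=> p [].
by move=> cr ci; split; apply: (measurable_funS measurable_closure sub);
  apply: within_continuous_measurable_plane => //; exact: measurable_closure.
Qed.

Lemma squeeze_twice_sum (a b c : nat -> \bar R) :
  (forall n, 0 <= a n)%E -> (forall n, a n <= 2%:E * (b n + c n))%E ->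
  b n @[n --> \oo] --> 0%E -> c n @[n --> \oo] --> 0%E -> a n @[n --> \oo] --> 0%E.
Proof.
move=> a0 abc b0 c0.
apply: (@squeeze_cvge _ _ _ _ (cst 0%E) _ (fun n => 2%:E * (b n + c n))%E).
- by apply: nearW => n; rewrite a0 abc.
- exact: cvg_cst.
rewrite -[X in _ --> X](mule0 2%:E) -[X in _ --> (_ * X)%E](adde0 0%E).
by apply: cvgeZl => //; apply: cvgeD.
Qed.

Lemma dist2_ge0 {d} {T : measurableType d} (mu : {measure set T -> \bar R}) D f g :
  (0 <= dist2 mu D f g)%E.
Proof. by apply: integral_ge0 => x _; rewrite lee_fin sqmod_ge0. Qed.

Lemma H1_dist2_sub (u1 u2 v1 v2 : H1 O) :
  (H1_dist2 (H1_sub oO bO u1 u2) (H1_sub oO bO v1 v2) <=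
   2%:E * (H1_dist2 u1 v1 + H1_dist2 u2 v2))%E.
Proof.
have mO := open_measurable_plane oO.
rewrite /H1_dist2 /=.
have le3 (a b c a1 b1 c1 a2 b2 c2 : \bar R) : (0 <= a1 -> 0 <= b1 -> 0 <= c1 ->
   0 <= a2 -> 0 <= b2 -> 0 <= c2 ->
   a <= 2%:E * (a1 + a2) -> b <= 2%:E * (b1 + b2) -> c <= 2%:E * (c1 + c2) ->
   a + b + c <= 2%:E * ((a1 + b1 + c1) + (a2 + b2 + c2)))%E.
  move=> ? ? ? ? ? ? Ha Hb Hc.
  rewrite (_ : (_ + _ + _ + (_ + _ + _) = (a1 + a2) + (b1 + b2) + (c1 + c2))%E).
    rewrite (@ge0_muleDr _ _ (a1 + a2 + (b1 + b2))%E) ?adde_ge0//.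
    rewrite (@ge0_muleDr _ _ (a1 + a2)%E) ?adde_ge0//.
    by apply: leeD => //; exact: leeD.
  by rewrite addeACA (addeACA a1).
apply: le3; [exact: dist2_ge0..| | |].
- exact: (@dist2_sub_le _ _ _ (leb2 R) O mO _ _ _ _ (proj1 (h1_L2 u1))
    (proj1 (h1_L2 u2)) (proj1 (h1_L2 v1)) (proj1 (h1_L2 v2))).
- exact: (@dist2_sub_le _ _ _ (leb2 R) O mO _ _ _ _ (proj1 (h1_dx_L2 u1))
    (proj1 (h1_dx_L2 u2)) (proj1 (h1_dx_L2 v1)) (proj1 (h1_dx_L2 v2))).
- exact: (@dist2_sub_le _ _ _ (leb2 R) O mO _ _ _ _ (proj1 (h1_dy_L2 u1))
    (proj1 (h1_dy_L2 u2)) (proj1 (h1_dy_L2 v1)) (proj1 (h1_dy_L2 v2))).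
Qed.

Lemma H1_dist2_ge0 (u v : H1 O) : (0 <= H1_dist2 u v)%E.
Proof. by apply: adde_ge0; [apply: adde_ge0|]; exact: dist2_ge0. Qed.

(** The differences of two approximating sequences approximate the difference, by
  the quadratic triangle inequality in the domain and in each chart. *)
Lemma is_trace_sub (v1 v2 : H1 O) (g1 g2 : R * R -> R[i]) :
  is_trace v1 g1 -> is_trace v2 g2 ->
  is_trace (H1_sub oO bO v1 v2) (fun p => g1 p - g2 p).
Proof.
move=> [mg1 [w1 [cw1 hw1 bw1]]] [mg2 [w2 [cw2 hw2 bw2]]].
split; first exact: cmeasurable_sub.
exists (fun n => H1_sub oO bO (w1 n) (w2 n)); split.
- move=> n; have [c1 c1'] := cw1 n; have [c2 c2'] := cw2 n.
  rewrite /= ReF_sub ImF_sub; split.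
    exact: (within_continuousB c1 c2).
  exact: (within_continuousB c1' c2').
- apply: (squeeze_twice_sum _ _ hw1 hw2) => n; first exact: H1_dist2_ge0.
  exact: H1_dist2_sub.
- move=> c hc.
  apply: (squeeze_twice_sum _ _ (bw1 c hc) (bw2 c hc)) => n; first exact: dist2_ge0.
  have mD : measurable (chart_dom c) by apply: open_measurable; exact: interval_open.
  apply: dist2_sub_le => //.
  + by apply: (cmeasurable_chart hc); case: (cw1 n); exact: cmeasurable_bdry_continuous.
  + by apply: (cmeasurable_chart hc); case: (cw2 n); exact: cmeasurable_bdry_continuous.
  + exact: (cmeasurable_chart hc).
  + exact: (cmeasurable_chart hc).
Qed.

(** The constant sequence is an approximating sequence. *)
Lemma is_trace_continuous (v : H1 O) (g : R * R -> R[i]) :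
  continuous (ReF v) -> continuous (ImF v) ->
  (forall p, bdry O p -> v p = g p) -> is_trace v g.
Proof.
move=> cr ci vg.
have cr' : {within closure O, continuous (ReF v)} by exact: continuous_subspaceT.
have ci' : {within closure O, continuous (ImF v)} by exact: continuous_subspaceT.
have dist0 d (T : measurableType d) (mu : {measure set T -> \bar R}) D (f1 f2 : T -> R[i]) :
    (forall x, D x -> f1 x = f2 x) -> dist2 mu D f1 f2 = 0%E.
  move=> f12; apply: integral0_eq => x Dx.
  by rewrite f12// subrr /sqmod/= expr0n/= addr0.
split.
  have [mr mi] := cmeasurable_bdry_continuous cr' ci'.
  by split; [apply: eq_measurable_fun mr|apply: eq_measurable_fun mi] => p /set_mem bp;
    rewrite /ReF /ImF vg.
exists (fun=> v); split => //.
- rewrite /H1_dist2 !dist0// !adde0; exact: cvg_cst.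
- move=> c hc; rewrite /= dist0; first exact: cvg_cst.
  by move=> s sD; apply: vg; exact: chart_graph_bdry.
Qed.

End Traces.

(** * Elements of H^1 with prescribed trace on Gamma *)

Section TraceOnGamma.
Context {R : realType}.
Variable O : set (R * R).
Hypotheses (oO : open O) (bO : bounded_set O).
Hypothesis hlip : lipschitz_boundary O.
Hypothesis hGamma : forall x, Gamma x -> bdry O (x, 0).

Lemma ae_imply {d} {T : measurableType d} (mu : {measure set T -> \bar R}) (P Q : T -> Prop) :
  (forall x, P x -> Q x) -> {ae mu, forall x, P x} -> {ae mu, forall x, Q x}.
Proof. by move=> PQ; apply: filterS. Qed.

Lemma cint_ae0 {d} {T : measurableType d} (mu : {measure set T -> \bar R}) D (f : T -> R[i]) :
  measurable D -> cmeasurable D f -> {ae mu, forall x, D x -> f x = 0} ->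
  cint mu D f = 0.
Proof.
move=> mD [rf jf] f0; rewrite /cint /Rintegral.
rewrite (@ae_eq_integral _ _ _ mu D (cst 0%E)) ?integral0//; first last.
- by apply: filterS f0 => x + Dx => /(_ Dx); rewrite /ReF/= => ->.
- exact/measurable_EFinP.
rewrite (@ae_eq_integral _ _ _ mu D (cst 0%E)) ?integral0//.
- exact/measurable_EFinP.
- by apply: filterS f0 => x + Dx => /(_ Dx); rewrite /ImF/= => ->.
Qed.

Lemma cmeasurable_line (I : set R) (g : R * R -> R[i]) : measurable I -> I `<=` Gamma ->
  cmeasurable (bdry O) g -> cmeasurable I (fun x => g (x, 0)).
Proof.
move=> mI IG [rg ig].
have mpair : measurable_fun I (fun x : R => (x, 0 : R)).
  by apply: (@measurable_funS _ _ _ _ setT) => //; exact: measurable_fun_pair.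
have sub : [set (x, 0 : R) | x in I] `<=` bdry O.
  by move=> _ [x /IG Gx <-]; exact: hGamma.
by split; [exact: (measurable_comp (@measurable_bdry R O) sub rg mpair)|
           exact: (measurable_comp (@measurable_bdry R O) sub ig mpair)].
Qed.

Lemma is_distr_dx_ae0 (I : set R) (g : R * R -> R[i]) : open I -> I `<=` Gamma ->
  cmeasurable (bdry O) g ->
  {ae (leb1 R), forall x, Gamma x -> g (x, 0) = 0} ->
  is_distr_dx I (fun x => g (x, 0)) (fun=> 0).
Proof.
move=> oI IG mg g0 psi tpsi.
have mI := open_measurable oI.
rewrite cint_eq0; last by move=> x _; rewrite mul0r.
rewrite /distr_dx cint_ae0 ?oppr0//.
- apply: (cmeasurable_mul (cmeasurable_line mI IG mg)).
  have [[_ _ c1] [_ _ c2]] := test_function_C1 (1 : R) tpsi.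
  by split; apply: (@measurable_funS _ _ _ _ setT) => //; exact: continuous_measurable_fun.
- apply: (@ae_imply _ _ (leb1 R) _ _ _ g0) => x + /IG Gx => /(_ Gx) ->.
  by rewrite mul0r.
Qed.

Lemma Gamma_m_sub : @Gamma_m R `<=` Gamma.
Proof. by move=> x; rewrite /Gamma_m /Gamma/= !in_itv/= => /andP[-> /lt_trans->]. Qed.

Lemma Gamma_p_sub : @Gamma_p R `<=` Gamma.
Proof.
by move=> x; rewrite /Gamma_p /Gamma/= !in_itv/= => /andP[x0 ->]; rewrite (lt_trans _ x0)// ltrN10.
Qed.

Lemma Gamma_m_open : open (@Gamma_m R). Proof. exact: interval_open. Qed.
Lemma Gamma_p_open : open (@Gamma_p R). Proof. exact: interval_open. Qed.

Lemma L2_cst0 (I : set R) (k : R -> R[i]) : L2 (leb1 R) I (fun x => k x * 0).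
Proof.
have -> : (fun x => k x * 0) = (fun=> 0) by apply/funext => x; rewrite mulr0.
split; first by split; exact: measurable_cst.
by rewrite integral0_eq ?ltry// => x _; rewrite /sqmod/= expr0n/= addr0.
Qed.

(** A trace that vanishes on [Gamma] has zero derivative there, and zero satisfies
  the weighted integrability conditions for every [alpha]. *)
Definition Walpha_of_null_trace (alpha : R) (v : H1 O) (g : R * R -> R[i])
    (vg : is_trace v g) (g0 : {ae (leb1 R), forall x, Gamma x -> g (x, 0) = 0}) :
  Walpha O alpha :=
  MkWalpha vg
    (is_distr_dx_ae0 Gamma_m_open Gamma_m_sub vg.1 g0)
    (is_distr_dx_ae0 Gamma_p_open Gamma_p_sub vg.1 g0)
    (L2_cst0 Gamma_m _) (L2_cst0 Gamma_p _).

Lemma L2_weight (I : set R) (k : R -> R) (q : R -> R[i]) : open I -> I `<=` Gamma ->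
  measurable_fun I k -> (forall x, I x -> 0 <= k x <= 1) ->
  continuous (ReF q) -> continuous (ImF q) ->
  L2 (leb1 R) I (fun x => (k x)%:C * q x).
Proof.
move=> oI IG mk k01 cr ci; have mI := open_measurable oI.
have IJ : I `<=` [set` `[-1, 1]].
  move=> x /IG; rewrite /Gamma/= !in_itv/= => /andP[/ltW-> /ltW->//].
have [B1 _ H1] := continuous_bounded_on_compact (@segment_compact R (-1) 1) cr.
have [B2 _ H2] := continuous_bounded_on_compact (@segment_compact R (-1) 1) ci.
apply: (@L2_bounded _ _ _ (leb1 R) I mI _ (B1 ^+ 2 + B2 ^+ 2)).
- apply: (@le_lt_trans _ _ (leb1 R [set` `[-1, 1]])).
    by apply: le_measure => //; rewrite inE//; exact: measurable_itv.
  by rewrite lebesgue_measure_itv/=; case: ifP => _; rewrite ?ltry// -EFinD ltry.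
- apply: cmeasurable_mul; first by split => //; exact: measurable_cst.
  by split; apply: (@measurable_funS _ _ _ _ setT) => //; exact: continuous_measurable_fun.
move=> x Ix; have Jx := IJ _ Ix; have /andP[k0 k1] := k01 _ Ix.
have -> : sqmod ((k x)%:C * q x) = k x ^+ 2 * (ReF q x ^+ 2 + ImF q x ^+ 2).
  by rewrite /sqmod /ReF /ImF; case: (q x) => a b /=; ring.
apply: (@le_trans _ _ (ReF q x ^+ 2 + ImF q x ^+ 2)).
  by rewrite ler_piMl ?addr_ge0 ?sqr_ge0// expr_le1.
by rewrite -[leLHS]/(sqmod (q x)); apply: sqmod_le; [exact: H1|exact: H2].
Qed.

Lemma powR_01 (r x : R) : 0 <= r -> 0 <= x <= 1 -> 0 <= x `^ r <= 1.
Proof.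
move=> r0 /andP[x0 x1]; rewrite powR_ge0/=.
by have := @ge0_ler_powR R r r0 x 1; rewrite !nnegrE powR1; apply.
Qed.

(** Where the cutoff is nonzero above the support of [psi], the boundary reduces
  to [Gamma], on which the cutoff is 1. *)
Lemma test_lift_trace (psi : R -> R[i]) (K : set R) : compact K -> K `<=` Gamma ->
  (forall x, ~ K x -> psi x = 0) -> cC1_along (1 : R) psi ->
  exists v : H1 O, is_trace v (zero_ext psi).
Proof.
move=> cK KG psi0 Cpsi.
have [e e0 He] := bdry_flat_compact hlip hGamma cK KG.
have [cx cy] := cC1_lift e Cpsi.
have [[cr _ _] [ci _ _]] := cx.
exists (H1_of_C1 oO bO cx cy); apply: is_trace_continuous => //.
move=> [x y] bxy; rewrite /= /lift /zero_ext/=.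
have [->|y0] := eqVneq y 0; first by rewrite cutoff0 mulr1.
have [Kx|/psi0 ->] := pselect (K x); last by rewrite mul0r.
rewrite cutoff_eq0 ?mulr0// leNgt; apply/negP => ye.
by move/eqP : y0; apply; exact: (He x).
Qed.

Lemma Walpha_of_lift (alpha : R) (psi : R -> R[i]) (K : set R) : 0 <= alpha ->
  compact K -> K `<=` Gamma ->
  (forall x, ~ K x -> psi x = 0) -> cC1_along (1 : R) psi ->
  exists v : Walpha O alpha, [/\ is_trace v (zero_ext psi),
    w_dm v = cderive (1 : R) psi & w_dp v = cderive (1 : R) psi].
Proof.
move=> a0 cK KG psi0 Cpsi.
have [v tv] := test_lift_trace cK KG psi0 Cpsi.
have zE : (fun x => zero_ext psi (x, 0)) = psi.
  by apply/funext => x; rewrite /zero_ext/= eqxx.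
have dm : is_distr_dx Gamma_m (fun x => zero_ext psi (x, 0)) (cderive (1 : R) psi).
  by rewrite zE; apply: is_distr_dx_C1 => //; exact: Gamma_m_open.
have dp : is_distr_dx Gamma_p (fun x => zero_ext psi (x, 0)) (cderive (1 : R) psi).
  by rewrite zE; apply: is_distr_dx_C1 => //; exact: Gamma_p_open.
have [[_ _ cr] [_ _ ci]] := Cpsi.
(* Since [alpha] is nonnegative, the weights are at most 1 on [Gamma]. *)
have a20 : 0 <= alpha / 2 by rewrite divr_ge0.
have mm : measurable_fun (@Gamma_m R) (fun x => `|x| `^ (alpha / 2)).
  apply: (@measurable_funS _ _ _ _ setT) => //.
  exact: (measurableT_comp (measurable_powR _)).
have mp : measurable_fun (@Gamma_p R) (fun x => x `^ (alpha / 2)).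
  by apply: (@measurable_funS _ _ _ _ setT) => //; exact: measurable_powR.
have wm x : Gamma_m x -> 0 <= `|x| `^ (alpha / 2) <= 1.
  by move=> /Gamma_m_sub/GammaP xG; apply: powR_01 => //; rewrite normr_ge0 ltW.
have wp x : Gamma_p x -> 0 <= x `^ (alpha / 2) <= 1.
  rewrite /Gamma_p/= in_itv/= => /andP[x0 x1]; apply: powR_01 => //.
  by rewrite !ltW.
have Lm := @L2_weight _ _ (cderive (1 : R) psi) Gamma_m_open Gamma_m_sub mm wm cr ci.
have Lp := @L2_weight _ _ (cderive (1 : R) psi) Gamma_p_open Gamma_p_sub mp wp cr ci.
by exists (MkWalpha tv dm dp Lm Lp).
Qed.

End TraceOnGamma.

(** * The normal derivative of the weak solution *)

Section WeakSolution.
Context {R : realType}.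
Variables (O : set (R * R)) (alpha : R) (f : R * R -> R[i]) (u : Walpha O alpha).
Hypotheses (oO : open O) (bO : bounded_set O).
Hypothesis hlip : lipschitz_boundary O.
Hypothesis hGamma : forall x, Gamma x -> bdry O (x, 0).
Hypothesis alpha0 : 0 <= alpha.
Hypothesis hf : L2 (leb2 R) O f.
Hypothesis hu : forall v : Walpha O alpha,
  form u v = cint (leb2 R) O (fun p => f p * conjc (v p)).

Let mO : measurable O := open_measurable_plane oO.

(** The right-hand side of Green's formula for [u], when the Laplacian of [u] is
  [u - f]. *)
Definition green (v : H1 O) : R[i] :=
  cint (leb2 R) O (fun p => grad_prod u v p + (u p - f p) * conjc (v p)).

Let Lw : L2 (leb2 R) O (fun p => u p - f p) := @L2_sub _ _ _ (leb2 R) O mO _ _ (h1_L2 u) hf.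

Lemma integrable_grad_prod (v : H1 O) : cintegrable (leb2 R) O (grad_prod u v).
Proof.
apply: (@cintegrableD _ _ _ (leb2 R) O mO).
- apply: (@L2_mul_integrable _ _ _ (leb2 R) O mO _ (conjF (h1_dx v))); first exact: h1_dx_L2.
  exact: (@L2_conj _ _ _ (leb2 R) O _ (h1_dx_L2 v)).
- apply: (@L2_mul_integrable _ _ _ (leb2 R) O mO _ (conjF (h1_dy v))); first exact: h1_dy_L2.
  exact: (@L2_conj _ _ _ (leb2 R) O _ (h1_dy_L2 v)).
Qed.

Lemma integrable_mul_conj (g : R * R -> R[i]) (v : H1 O) : L2 (leb2 R) O g ->
  cintegrable (leb2 R) O (fun p => g p * conjc (v p)).
Proof.
move=> Lg; apply: (@L2_mul_integrable _ _ _ (leb2 R) O mO _ (conjF v)) => //.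
exact: (@L2_conj _ _ _ (leb2 R) O _ (h1_L2 v)).
Qed.

Lemma integrable_green (v : H1 O) :
  cintegrable (leb2 R) O (fun p => grad_prod u v p + (u p - f p) * conjc (v p)).
Proof.
apply: (@cintegrableD _ _ _ (leb2 R) O mO); first exact: integrable_grad_prod.
exact: integrable_mul_conj.
Qed.

Lemma green_Walpha (v : Walpha O alpha) : green v =
  cint (leb1 R) Gamma_m (fun x => (`|x| `^ alpha)%:C * w_dm u x * conjc (w_dm v x))
  - cint (leb1 R) Gamma_p (fun x => (x `^ alpha)%:C * w_dp u x * conjc (w_dp v x)).
Proof.
rewrite /green.
have -> : (fun p => grad_prod u v p + (u p - f p) * conjc (v p)) =
    (fun p => (grad_prod u v p + u p * conjc (v p)) - f p * conjc (v p)).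
  by apply/funext => p; ring.
rewrite (@cintB _ _ _ (leb2 R) O mO); last 2 first.
- apply: (@cintegrableD _ _ _ (leb2 R) O mO); first exact: integrable_grad_prod.
  by apply: integrable_mul_conj; exact: h1_L2.
- exact: integrable_mul_conj.
by rewrite -hu /form; ring.
Qed.

(** Such a [v] is admissible in the weak formulation and both boundary integrals
  vanish. *)
Lemma green_null_trace (v : H1 O) (g : R * R -> R[i]) : is_trace v g ->
  {ae (leb1 R), forall x, Gamma x -> g (x, 0) = 0} -> green v = 0.
Proof.
move=> vg g0; have := green_Walpha (Walpha_of_null_trace hGamma alpha vg g0).
move=> /= ->; rewrite !cint_eq0 ?subr0// => x _;
  by rewrite /= oppr0 mulr0.
Qed.

Lemma green_sub (v1 v2 : H1 O) : green (H1_sub oO bO v1 v2) = green v1 - green v2.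
Proof.
rewrite /green -(@cintB _ _ _ (leb2 R) O mO); [|exact: integrable_green..].
apply: eq_cint => p _; rewrite /grad_prod/= !rmorphB/=; ring.
Qed.

(** The difference of the two functions has trace zero. *)
Lemma green_trace (v1 v2 : H1 O) (g : R * R -> R[i]) :
  is_trace v1 g -> is_trace v2 g -> green v1 = green v2.
Proof.
move=> t1 t2; apply/eqP; rewrite -subr_eq0 -green_sub; apply/eqP.
apply: (green_null_trace (is_trace_sub oO bO t1 t2)).
by apply: aeW => x _; rewrite subrr.
Qed.

(** Green's formula prescribes the value at conjugates of traces, hence the
  conjugate of [h] is the trace to look for. The choice of [v] is immaterial by
  [green_trace], and the value outside H^{1/2} is a dummy. *)
Definition normal_derivative (h : R * R -> R[i]) : R[i] :=
  if pselect (exists v : H1 O, is_trace v (conjF h)) is left ex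
  then green (projT1 (cid ex)) else 0.

Lemma normal_derivativeE (v : H1 O) (g : R * R -> R[i]) : is_trace v g ->
  normal_derivative (conjF g) = green v.
Proof.
move=> vg; rewrite /normal_derivative; case: pselect => [ex|[]]; last first.
  by exists v; rewrite conjF_involutive.
case: cid => v' /=; rewrite conjF_involutive => v'g; exact: green_trace v'g vg.
Qed.

(** The conjugate of [phi] has trace zero, so [green] vanishes on it; two
  integrations by parts turn the gradient term into the distributional Laplacian. *)
Lemma green_test_function (phi : R * R -> R[i]) : test_function O phi ->
  cint (leb2 R) O (fun p => (u p - f p) * phi p) = distr_laplacian O u phi.
Proof.
move=> tphi.
have Cx := test_function_C1 dir_x tphi; have Cy := test_function_C1 dir_y tphi.
have tx := test_function_cderive dir_x tphi.
have ty := test_function_cderive dir_y tphi.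
pose v := H1_of_C1 oO bO (cC1_conj Cx) (cC1_conj Cy).
have v0 : is_trace v (fun=> 0).
  have [[cr _ _] [ci _ _]] := cC1_conj Cx.
  apply: is_trace_continuous => // p [_ nOp].
  have [_ _ [K [_ KO K0]]] := tphi.
  rewrite /v/= /conjF K0 /= ?oppr0// => /KO Op; apply: nOp.
  exact: open_nbhs_nbhs.
have green0 : green v = 0 by apply: (green_null_trace v0); apply: aeW.
have vx : h1_dx v = conjF (cderive dir_x phi) := cderive_conj Cx.
have vy : h1_dy v = conjF (cderive dir_y phi) := cderive_conj Cy.
pose gx p := h1_dx u p * cderive dir_x phi p.
pose gy p := h1_dy u p * cderive dir_y phi p.
pose gw p := (u p - f p) * phi p.
pose lx p := u p * cderive dir_x (cderive dir_x phi) p.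
pose ly p := u p * cderive dir_y (cderive dir_y phi) p.
have prod_int (a b : R * R -> R[i]) : L2 (leb2 R) O a -> test_function O b ->
    cintegrable (leb2 R) O (fun p => a p * b p).
  by move=> La /(test_function_L2 oO bO); exact: (@L2_mul_integrable _ _ _ (leb2 R) O mO).
have txx := test_function_cderive dir_x tx; have tyy := test_function_cderive dir_y ty.
have ix : cintegrable (leb2 R) O gx := prod_int _ _ (h1_dx_L2 u) tx.
have iy : cintegrable (leb2 R) O gy := prod_int _ _ (h1_dy_L2 u) ty.
have iw : cintegrable (leb2 R) O gw := prod_int _ _ Lw tphi.
have ixx : cintegrable (leb2 R) O lx := prod_int _ _ (h1_L2 u) txx.
have iyy : cintegrable (leb2 R) O ly := prod_int _ _ (h1_L2 u) tyy.
have Dx : cint (leb2 R) O lx = - cint (leb2 R) O gx := h1_dxP u tx.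
have Dy : cint (leb2 R) O ly = - cint (leb2 R) O gy := h1_dyP u ty.
have lapE : distr_laplacian O u phi = cint (leb2 R) O lx + cint (leb2 R) O ly.
  rewrite -(@cintD _ _ _ (leb2 R) O mO lx ly ixx iyy).
  by apply: eq_cint => p _; rewrite /laplacian mulrDr.
have greenE : green v = cint (leb2 R) O gx + cint (leb2 R) O gy + cint (leb2 R) O gw.
  rewrite -(@cintD _ _ _ (leb2 R) O mO gx gy ix iy).
  rewrite -(@cintD _ _ _ (leb2 R) O mO _ gw (@cintegrableD _ _ _ (leb2 R) O mO gx gy ix iy) iw).
  by apply: eq_cint => p _; rewrite /grad_prod vx vy /gx /gy /gw /conjF !conjcK.
have alg (a b c l1 l2 : R[i]) : l1 = - a -> l2 = - b -> a + b + c = 0 -> c = l1 + l2.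
  by move=> -> -> abc; rewrite -opprD; apply/eqP; rewrite -addr_eq0 addrC abc.
exact: (etrans (alg _ _ _ _ _ Dx Dy (etrans (esym greenE) green0)) (esym lapE)).
Qed.

Lemma weak_solution_pde : solves_pde O u f.
Proof.
move=> phi tphi; rewrite -green_test_function//.
have Lphi := test_function_L2 oO bO tphi.
have iu := @L2_mul_integrable _ _ _ (leb2 R) O mO _ _ (h1_L2 u) Lphi.
have if_ := @L2_mul_integrable _ _ _ (leb2 R) O mO _ _ hf Lphi.
have -> : (fun p => (u p - f p) * phi p) = (fun p => u p * phi p - f p * phi p).
  by apply/funext => p; rewrite mulrBl.
by rewrite (@cintB _ _ _ (leb2 R) O mO)// opprB subrK.
Qed.

Lemma normal_derivative_is : is_normal_derivative u normal_derivative.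
Proof.
exists (fun p => u p - f p); split; [exact: Lw|exact: green_test_function|].
by move=> v g vg; rewrite (normal_derivativeE vg).
Qed.

Lemma normal_derivative_Gamma0 : zero_on_Gamma0 O normal_derivative.
Proof.
move=> phi [v vphi] phi0; rewrite (normal_derivativeE vphi).
exact: green_null_trace vphi phi0.
Qed.

Lemma zero_ext_conj (psi : R -> R[i]) : conjF (zero_ext (conjF psi)) = zero_ext psi.
Proof.
apply/funext => p; rewrite /conjF /zero_ext; case: ifP => _ /=; last by rewrite oppr0.
by case: (psi p.1) => a b /=; rewrite opprK.
Qed.

(** [green_Walpha] for the lift of the conjugate of [psi]: the two conjugations
  cancel. *)
Lemma normal_derivative_test (psi : R -> R[i]) : test_function Gamma psi ->
  Hhalf O (zero_ext psi) /\
  normal_derivative (zero_ext psi) =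
    cint (leb1 R) Gamma_m (fun x => (`|x| `^ alpha)%:C * w_dm u x * cderive (1 : R) psi x)
    - cint (leb1 R) Gamma_p (fun x => (x `^ alpha)%:C * w_dp u x * cderive (1 : R) psi x).
Proof.
move=> tpsi; have Cpsi := test_function_C1 (1 : R) tpsi.
have [_ _ [K [cK KG psi0]]] := tpsi.
split; first exact: (test_lift_trace oO bO hlip hGamma cK KG psi0 Cpsi).
have cpsi0 x : ~ K x -> conjF psi x = 0.
  by move=> /psi0; rewrite /conjF => -> /=; rewrite oppr0.
have [v [tv vm vp]] := Walpha_of_lift oO bO hlip hGamma alpha0 cK KG cpsi0 (cC1_conj Cpsi).
rewrite -zero_ext_conj (normal_derivativeE tv) green_Walpha vm vp (cderive_conj Cpsi).
by congr (_ - _); apply: eq_cint => x _; rewrite /conjF conjcK.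
Qed.

Lemma test_function_sub (V : normedModType R) (I J : set V) (psi : V -> R[i]) : I `<=` J ->
  test_function I psi -> test_function J psi.
Proof.
by move=> IJ [sr si [K [cK KI K0]]]; split => //; exists K; split => // x /KI/IJ.
Qed.

Lemma cint_disjoint_test (I J : set R) (g psi : R -> R[i]) :
  (forall x, I x -> ~ J x) -> test_function I psi ->
  cint (leb1 R) J (fun x => g x * cderive (1 : R) psi x) = 0.
Proof.
move=> IJ [_ _ [K [cK KI K0]]]; apply: cint_eq0 => x Jx.
by rewrite (cderive_off_compact (1 : R) cK K0) ?mulr0// => /KI/IJ.
Qed.

Lemma Gamma_m_p_disjoint (x : R) : Gamma_m x -> ~ Gamma_p x.
Proof.
rewrite /Gamma_m /Gamma_p/= !in_itv/= => /andP[_ x0] /andP[/(lt_trans x0)].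
by rewrite ltxx.
Qed.

Lemma normal_derivative_Gamma_m : eq_distr_on O normal_derivative Gamma_m
  (fun psi => - distr_dx Gamma_m (fun x => (`|x| `^ alpha)%:C * w_dm u x) psi).
Proof.
move=> psi tpsi; have [H ->] := normal_derivative_test (test_function_sub (@Gamma_m_sub R) tpsi).
split => //; rewrite /distr_dx opprK [X in _ - X](cint_disjoint_test _ _ tpsi) ?subr0//.
exact: Gamma_m_p_disjoint.
Qed.

Lemma normal_derivative_Gamma_p : eq_distr_on O normal_derivative Gamma_p
  (distr_dx Gamma_p (fun x => (x `^ alpha)%:C * w_dp u x)).
Proof.
move=> psi tpsi; have [H ->] := normal_derivative_test (test_function_sub (@Gamma_p_sub R) tpsi).
split => //; rewrite /distr_dx [X in X - _](cint_disjoint_test _ _ tpsi) ?sub0r//.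
by move=> x px /Gamma_m_p_disjoint.
Qed.

End WeakSolution.

Theorem theorem2p7 (R : realType) (Omega : set (R * R))
    (hopen : open Omega) (hconn : connected Omega) (hbdd : bounded_set Omega)
    (hlip : lipschitz_boundary Omega)
    (hGamma : forall x, Gamma x -> bdry Omega (x, 0))
    (alpha : R) (halpha : 0 <= alpha)
    (f : R * R -> R[i]) (hf : L2 (leb2 R) Omega f)
    (u : Walpha Omega alpha)
    (hu : forall v : Walpha Omega alpha,
        form u v = cint (leb2 R) Omega (fun p => f p * conjc (v p))) :
  solves_pde Omega u f /\
  exists dnu : (R * R -> R[i]) -> R[i],
    [/\ is_normal_derivative u dnu,
        zero_on_Gamma0 Omega dnu,
        eq_distr_on Omega dnu Gamma_m
          (fun psi =>
             - distr_dx Gamma_m (fun x => (`|x| `^ alpha)%:C * w_dm u x) psi) &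
        eq_distr_on Omega dnu Gamma_p
          (distr_dx Gamma_p (fun x => (x `^ alpha)%:C * w_dp u x))].
Proof.
split; first exact: weak_solution_pde.
exists (normal_derivative f u); split.
- exact: normal_derivative_is.
- exact: normal_derivative_Gamma0.
- exact: normal_derivative_Gamma_m.
- exact: normal_derivative_Gamma_p.
Qed.
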